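(* Let $X_{\mathcal M}$ be a hypergraph PIN model on a $t$-uniform hypergraph $\mathcal H=(\mathcal M,\mathcal E)$, and suppose the source is Type $\mathcal S$. Then $$\mathrm{CI}(X_{\mathcal M})=\mathrm{CI}_W(X_{\mathcal M})=H(X_{\mathcal M})=|\mathcal E|,$$ and consequently $$R_{\mathrm{SK}}=R_{\mathrm{CO}}=\frac{m-t}{m-1}\,|\mathcal E|.$$
   Context: Setup. Let $\mathcal M=\{1,\dots,m\}$, $m\ge2$; $X_{\mathcal M}$ is a source with finite alphabets; $X^n_{\mathcal M}$ consists of $n$ i.i.d. copies; $X_A=(X_i:i\in A)$. Logs and entropies are base 2. Hypergraph PIN model. Given a hypergraph $\mathcal H=(\mathcal M,\mathcal E)$, with $\mathcal E$ a finite multiset of subsets (hyperedges) of $\mathcal M$, let $\mathcal E^{(n)}$ be the multiset with $n$ copies of each element of $\mathcal E$. To each $e\in\mathcal E^{(n)}$ attach a Bernoulli(1/2) random variable $\xi_e$, all mutually independent. Set $X^n_i=(\xi_e:e\in\mathcal E^{(n)},\ i\in e)$. $\mathcal H$ is $t$-uniform if $|e|=t$ for all $e\in\mathcal E$. Interactive communication, CR, SK. An interactive communication $\mathbf F$ is a finite sequence of transmissions; each is sent by some terminal $i$ and is a deterministic function of $X_i^n$ and earlier transmissions. Its range is $\mathcal F$. A CR $\mathbf J$ obtained from $\mathbf F$ is a sequence of functions of $X^n_{\mathcal M}$ such that for every $0<\epsilon<1$ and large $n$, there are $J_i(X^n_i,\mathbf F)$ with $\Pr[J_1=\cdots=J_m=\mathbf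 J]\ge1-\epsilon$. An SK is a CR $\mathbf K$ from $\mathbf F$ with $I(\mathbf K;\mathbf F)\le\epsilon$ for large $n$, for every $\epsilon>0$. Multipartite information. $\Delta(\mathcal P)=\frac{1}{|\mathcal P|-1}[\sum_{A\in\mathcal P}H(X_A)-H(X_{\mathcal M})]$ for partitions $\mathcal P$ with $|\mathcal P|\ge2$, and $\mathbf I(X_{\mathcal M})=\min_{\mathcal P}\Delta(\mathcal P)$. The source is Type $\mathcal S$ if the singleton partition $\mathcal S=\{\{1\},\dots,\{m\}\}$ attains this minimum. Communication rates. $R_{\mathrm{CO}}=\min\{\sum_{i}R_i:\sum_{i\in B}R_i\ge H(X_B|X_{B^c})\ \forall\emptyset\ne B\subsetneq\mathcal M\}$. $R_{\mathrm{SK}}$ is the infimum of $R\ge0$ such that for every $\epsilon>0$ and large $n$ there exist $\mathbf F$ with $\frac1n\log|\mathcal F|\le R+\epsilon$ and an SK $\mathbf K$ from $\mathbf F$ with $\frac1nH(\mathbf K)\ge\mathbf I(X_{\mathcal M})-\epsilon$. Common information. $\mathbf I(X^n_{\mathcal M}|\mathbf L)=\max_{\mathcal P^*}\frac{1}{|\mathcal P^*|-1}[\sum_{A\in\mathcal P^*}H(X^n_A|\mathbf L)-H(X^n_{\mathcal M}|\mathbf L)]$, with the maximum over minimizers $\mathcal P^*$ of $\Delta$. A $\mathrm{CI}_W$ is a sequence of functions $\mathbf L^{(n)}(X^n_{\mathcal M})$ with $\frac1n\mathbf I(X^n_{\mathcal M}|\mathbf L^{(n)})\to0$; a CI is a $\mathrm{CI}_W$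 of the form $(\mathbf J,\mathbf F)$ with $\mathbf J$ a CR from $\mathbf F$. $\mathrm{CI}_W(X_{\mathcal M})$ (resp. $\mathrm{CI}(X_{\mathcal M})$) is the infimum of $R$ such that some $\mathrm{CI}_W$ (resp. CI) $\mathbf L$ has $\frac1nH(\mathbf L)\le R+\epsilon$ for large $n$, for all $\epsilon>0$.
   Formalization: The formal theorem assumes t ≥ 2; for t = 1 with |E| > 0 the source is Type S with I = 0, so CI_W = 0 and R_SK = 0 rather than |E|, and for t = 0 with |E| > 0 one has H(X_M) = 0, not |E|. *)

(* Defs.v *)
From Stdlib Require Import Reals Lra List Arith Bool Permutation ClassicalEpsilon.
Import ListNotations.
Open Scope R_scope.

Definition log2 (x : R) : R := ln x / ln 2.
Definition sum_R (l : list R) : R := fold_right Rplus 0 l.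

Fixpoint all_bits (N : nat) : list (list bool) :=
  match N with
  | O => [[]]
  | S k => flat_map (fun w => [false :: w; true :: w]) (all_bits k)
  end.

Definition prob (N : nat) (P : list bool -> bool) : R :=
  INR (length (filter P (all_bits N))) / 2 ^ N.

Definition dec (T : Type) := forall x y : T, {x = y} + {x <> y}.

Definition pair_dec {A B : Type} (da : dec A) (db : dec B) : dec (A * B).
Proof.
  intros [a b] [c d]. destruct (da a c) as [e1|n1].
  - destruct (db b d) as [e2|n2].
    + left; subst; reflexivity.
    + right; intros H; inversion H; contradiction.
  - right; intros H; inversion H; contradiction.
Defined.

Definition dN : dec nat := Nat.eq_dec.
Definition dLN : dec (list nat) := list_eq_dec Nat.eq_dec.
Definition dLB : dec (list bool) := list_eq_dec bool_dec.
Definition dLLB : dec (list (list bool)) := list_eq_dec dLB.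

Definition entropy {T : Type} (d : dec T) (N : nat) (f : list bool -> T) : R :=
  - (sum_R (map (fun w => log2 (prob N (fun w' => if d (f w') (f w) then true else false)))
                (all_bits N)) / 2 ^ N).

Definition centropy {A B : Type} (da : dec A) (db : dec B) (N : nat)
  (f : list bool -> A) (g : list bool -> B) : R :=
  entropy (pair_dec da db) N (fun w => (f w, g w)) - entropy db N g.

Definition minfo {A B : Type} (da : dec A) (db : dec B) (N : nat)
  (f : list bool -> A) (g : list bool -> B) : R :=
  entropy da N f + entropy db N g - entropy (pair_dec da db) N (fun w => (f w, g w)).

(** * Hypergraph PIN model.
    Terminals are 0, ..., m-1. A hypergraph is a list (multiset) of hyperedges,
    each hyperedge a duplicate-free list of terminals. *)
Definition hypergraph := list (list nat).

Definition inE (i : nat) (e : list nat) : bool := existsb (Nat.eqb i) e.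

Definition well_formed (m : nat) (E : hypergraph) : Prop :=
  Forall (fun e => NoDup e /\ Forall (fun i => (i < m)%nat) e) E.

Definition uniform (t : nat) (E : hypergraph) : Prop :=
  Forall (fun e => length e = t) E.

(** At blocklength n the sample space consists of the n*|E| independent uniform bits
    xi_(j,k) (copy j < n of hyperedge k < |E|), stored at position j*|E|+k. *)
Definition NN (E : hypergraph) (n : nat) : nat := (n * length E)%nat.

Definition bit (E : hypergraph) (w : list bool) (j k : nat) : bool :=
  nth (j * length E + k)%nat w false.

Definition obs (E : hypergraph) (n i : nat) (w : list bool) : list bool :=
  flat_map (fun j => map (fun k => bit E w j k)
                         (filter (fun k => inE i (nth k E [])) (seq 0 (length E))))
           (seq 0 n).

Definition obsA (E : hypergraph) (n : nat) (A : list nat) (w : list bool) : list (list bool) :=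
  map (fun i => obs E n i w) A.

Definition XM (m : nat) (E : hypergraph) (n : nat) (w : list bool) : list (list bool) :=
  obsA E n (seq 0 m) w.

Definition HA (E : hypergraph) (A : list nat) : R := entropy dLLB (NN E 1) (obsA E 1 A).

Definition is_partition (m : nat) (P : list (list nat)) : Prop :=
  Permutation (concat P) (seq 0 m) /\ Forall (fun B => B <> []) P.

Definition admissible (m : nat) (P : list (list nat)) : Prop :=
  is_partition m P /\ (2 <= length P)%nat.

Definition Delta (m : nat) (E : hypergraph) (P : list (list nat)) : R :=
  (sum_R (map (HA E) P) - HA E (seq 0 m)) / INR (length P - 1).

Definition singletons (m : nat) : list (list nat) := map (fun i => [i]) (seq 0 m).

Definition typeS (m : nat) (E : hypergraph) : Prop :=
  forall P, admissible m P -> Delta m E (singletons m) <= Delta m E P.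

Definition is_min (S : R -> Prop) (x : R) : Prop := S x /\ forall y, S y -> x <= y.
Definition is_max (S : R -> Prop) (x : R) : Prop := S x /\ forall y, S y -> y <= x.
Definition is_inf (S : R -> Prop) (x : R) : Prop :=
  (forall y, S y -> x <= y) /\ (forall z, (forall y, S y -> z <= y) -> z <= x).

Definition MMI (m : nat) (E : hypergraph) : R :=
  epsilon (inhabits 0) (is_min (fun x => exists P, admissible m P /\ Delta m E P = x)).

Definition co_subset (m : nat) (B : list nat) : Prop :=
  NoDup B /\ incl B (seq 0 m) /\ B <> [] /\ (length B < m)%nat.

Definition compl (m : nat) (B : list nat) : list nat :=
  filter (fun i => negb (inE i B)) (seq 0 m).

Definition co_feasible (m : nat) (E : hypergraph) (Rv : nat -> R) : Prop :=
  forall B, co_subset m B ->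
    sum_R (map Rv B) >= centropy dLLB dLLB (NN E 1) (obsA E 1 B) (obsA E 1 (compl m B)).

Definition co_sums (m : nat) (E : hypergraph) (x : R) : Prop :=
  exists Rv, co_feasible m E Rv /\ sum_R (map Rv (seq 0 m)) = x.

(** * Interactive communication.
    A protocol is a finite list of rounds (i, g): terminal i sends g(previous
    transmissions, X_i^n). *)
Definition round := (nat * (list nat -> list bool -> nat))%type.
Definition protocol := list round.

Definition valid_protocol (m : nat) (p : protocol) : Prop :=
  Forall (fun r => (fst r < m)%nat) p.

Fixpoint run (p : protocol) (X : nat -> list bool) (acc : list nat) : list nat :=
  match p with
  | [] => acc
  | (i, g) :: p' => run p' X (acc ++ [g acc (X i)])
  end.

Definition transcript (E : hypergraph) (n : nat) (p : protocol) (w : list bool) : list nat :=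
  run p (fun i => obs E n i w) [].

Definition range_size (E : hypergraph) (n : nat) (p : protocol) : nat :=
  length (nodup dLN (map (transcript E n p) (all_bits (NN E n)))).

Definition eventually (P : nat -> Prop) : Prop :=
  exists N0, forall n, (N0 <= n)%nat -> P n.

Definition is_CR (m : nat) (E : hypergraph) (Fs : nat -> protocol)
  (J : nat -> list (list bool) -> nat) : Prop :=
  forall eps, eps > 0 -> eventually (fun n =>
    exists Dec : nat -> list bool -> list nat -> nat,
      prob (NN E n) (fun w => forallb (fun i =>
             Nat.eqb (Dec i (obs E n i w) (transcript E n (Fs n) w)) (J n (XM m E n w)))
             (seq 0 m)) >= 1 - eps).

Definition is_SK (m : nat) (E : hypergraph) (Fs : nat -> protocol)
  (K : nat -> list (list bool) -> nat) : Prop :=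
  is_CR m E Fs K /\
  forall eps, eps > 0 -> eventually (fun n =>
    minfo dN dLN (NN E n) (fun w => K n (XM m E n w)) (transcript E n (Fs n)) <= eps).

Definition SK_achievable (m : nat) (E : hypergraph) (R0 : R) : Prop :=
  0 <= R0 /\
  forall eps, eps > 0 -> exists (Fs : nat -> protocol) (K : nat -> list (list bool) -> nat),
    (forall n, valid_protocol m (Fs n)) /\ is_SK m E Fs K /\
    eventually (fun n =>
      log2 (INR (range_size E n (Fs n))) / INR n <= R0 + eps /\
      entropy dN (NN E n) (fun w => K n (XM m E n w)) / INR n >= MMI m E - eps).

Definition cDelta {T : Type} (d : dec T) (m : nat) (E : hypergraph) (n : nat)
  (L : list bool -> T) (P : list (list nat)) : R :=
  (sum_R (map (fun A => centropy dLLB d (NN E n) (obsA E n A) L) P)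
   - centropy dLLB d (NN E n) (XM m E n) L) / INR (length P - 1).

Definition minimizer (m : nat) (E : hypergraph) (P : list (list nat)) : Prop :=
  admissible m P /\ Delta m E P = MMI m E.

Definition condMMI {T : Type} (d : dec T) (m : nat) (E : hypergraph) (n : nat)
  (L : list bool -> T) : R :=
  epsilon (inhabits 0)
    (is_max (fun x => exists P, minimizer m E P /\ cDelta d m E n L P = x)).

Definition is_CIW {T : Type} (d : dec T) (m : nat) (E : hypergraph)
  (L : nat -> list bool -> T) : Prop :=
  forall eps, eps > 0 -> eventually (fun n => Rabs (condMMI d m E n (L n) / INR n) <= eps).

Definition CIW_achievable (m : nat) (E : hypergraph) (R0 : R) : Prop :=
  exists L : nat -> list (list bool) -> nat,
    is_CIW dN m E (fun n w => L n (XM m E n w)) /\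
    forall eps, eps > 0 -> eventually (fun n =>
      entropy dN (NN E n) (fun w => L n (XM m E n w)) / INR n <= R0 + eps).

Definition CI_achievable (m : nat) (E : hypergraph) (R0 : R) : Prop :=
  exists (Fs : nat -> protocol) (J : nat -> list (list bool) -> nat),
    (forall n, valid_protocol m (Fs n)) /\ is_CR m E Fs J /\
    is_CIW (pair_dec dN dLN) m E (fun n w => (J n (XM m E n w), transcript E n (Fs n) w)) /\
    forall eps, eps > 0 -> eventually (fun n =>
      entropy (pair_dec dN dLN) (NN E n)
        (fun w => (J n (XM m E n w), transcript E n (Fs n) w)) / INR n <= R0 + eps).

(* Main.v *)
(* Common information. Every bit xi_e is seen by exactly t terminals, so Shearer's inequality
   gives sum_i H(X_i^n | L) >= t H(X_M^n | L) for every function L of the source. Under Type S the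
   singleton partition is a minimizer of Delta, so if L is a CI_W then (t - 1) H(X_M^n | L) = o(n),
   i.e. H(L) >= n|E| - o(n). Revealing everything attains |E|.

   Omniscience. R_i = deg i - (t-1)|E|/(m-1) is feasible: the constraint for B is Type S applied to
   the partition into the complement of B and the singletons of B. Summing the constraints for the
   sets M \ {i} shows that its total (m-t)|E|/(m-1) is least.

   Lower bound on R_SK. For interactive F, sum_i I(X_i^n; F) >= H(F). Combined with Shearer's
   inequality for L = (K, F) and Fano's inequality H(K | X_i^n, F) = o(n), this gives
   (m - t) H(K, F) <= (m - 1) H(F) + o(n); and H(K, F) >= H(F) + n(t-1)|E|/(m-1) - o(n).

   Achievability. If terminal i sends about n R_i parity checks of its observation, chosen by a
   derandomised union bound, then every terminal recovers the whole source without error. The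
   transcript F is linear, so its fibres all have the same size, and the index of the source word
   in its fibre is a key exactly independent of F. *)

From Stdlib Require Import Reals Lra Lia List ZArith Bool Permutation ClassicalEpsilon Classical.
Require Import Defs.
Import ListNotations.
Open Scope R_scope.

(** * Finite real sums indexed by lists *)

Definition sumf {A : Type} (l : list A) (f : A -> R) : R := sum_R (map f l).

Lemma sumf_nil {A} (f : A -> R) : sumf [] f = 0.
Proof. reflexivity. Qed.

Lemma sumf_cons {A} (a : A) l f : sumf (a :: l) f = f a + sumf l f.
Proof. reflexivity. Qed.

Lemma sumf_app {A} (l1 l2 : list A) f : sumf (l1 ++ l2) f = sumf l1 f + sumf l2 f.
Proof.
  induction l1 as [|a l1 IH]; cbn [app]; rewrite ?sumf_nil, ?sumf_cons, ?IH; lra.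
Qed.

Lemma sumf_ext {A} (l : list A) f g :
  (forall a, In a l -> f a = g a) -> sumf l f = sumf l g.
Proof. intros H. unfold sumf. f_equal. now apply map_ext_in. Qed.

Lemma sumf_le {A} (l : list A) f g :
  (forall a, In a l -> f a <= g a) -> sumf l f <= sumf l g.
Proof.
  induction l as [|a l IH]; intros H; [rewrite !sumf_nil; lra|].
  rewrite !sumf_cons. apply Rplus_le_compat; [apply H; now left|].
  apply IH; intros; apply H; now right.
Qed.

Lemma sumf_plus {A} (l : list A) f g : sumf l (fun a => f a + g a) = sumf l f + sumf l g.
Proof. induction l as [|a l IH]; rewrite ?sumf_nil, ?sumf_cons, ?IH; lra. Qed.

Lemma sumf_minus {A} (l : list A) f g : sumf l (fun a => f a - g a) = sumf l f - sumf l g.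
Proof. induction l as [|a l IH]; rewrite ?sumf_nil, ?sumf_cons, ?IH; lra. Qed.

Lemma sumf_scal {A} (l : list A) c f : sumf l (fun a => c * f a) = c * sumf l f.
Proof. induction l as [|a l IH]; rewrite ?sumf_nil, ?sumf_cons, ?IH; lra. Qed.

Lemma sumf_const {A} (l : list A) c : sumf l (fun _ => c) = INR (length l) * c.
Proof.
  induction l as [|a l IH]; rewrite ?sumf_nil, ?sumf_cons, ?IH; cbn [length];
    rewrite ?S_INR; simpl; lra.
Qed.

Lemma sumf_nonneg {A} (l : list A) f : (forall a, In a l -> 0 <= f a) -> 0 <= sumf l f.
Proof.
  intros H. pose proof (sumf_le l (fun _ => 0) f H) as H0.
  rewrite sumf_const in H0. lra.
Qed.

Lemma sumf_swap {A B} (l : list A) (k : list B) (f : A -> B -> R) :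
  sumf l (fun a => sumf k (f a)) = sumf k (fun b => sumf l (fun a => f a b)).
Proof.
  induction l as [|a l IH].
  - rewrite sumf_nil, (sumf_ext k _ (fun _ => 0)) by reflexivity.
    rewrite sumf_const; lra.
  - rewrite sumf_cons, IH, <- sumf_plus. reflexivity.
Qed.

Lemma sumf_perm {A} (l l' : list A) f : Permutation l l' -> sumf l f = sumf l' f.
Proof.
  induction 1; rewrite ?sumf_nil, ?sumf_cons; try lra.
Qed.

Definition b2r (b : bool) : R := if b then 1 else 0.

Lemma b2r_nonneg b : 0 <= b2r b.
Proof. destruct b; simpl; lra. Qed.

Lemma sumf_b2r {A} (P : A -> bool) l : sumf l (fun a => b2r (P a)) = INR (length (filter P l)).
Proof.
  induction l as [|a l IH]; [reflexivity|].
  rewrite sumf_cons, IH. cbn [filter]. destruct (P a); cbn [length b2r]; rewrite ?S_INR; lra.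
Qed.

Lemma sumf_filter {A} (P : A -> bool) l f :
  sumf (filter P l) f = sumf l (fun a => b2r (P a) * f a).
Proof.
  induction l as [|a l IH]; [reflexivity|].
  cbn [filter]. destruct (P a) eqn:E; rewrite ?sumf_cons, ?E, IH; cbn [b2r]; lra.
Qed.

Lemma sumf_single {A} (d : dec A) (l : list A) (x : A) c :
  NoDup l -> In x l -> sumf l (fun y => if d y x then c else 0) = c.
Proof.
  intros Hn. induction Hn as [|y l Hy Hn IH]; intros Hx; [contradiction|].
  rewrite sumf_cons. destruct (d y x) as [->|Hne].
  - rewrite (sumf_ext l _ (fun _ => 0)), sumf_const; [lra|].
    intros a Ha. destruct (d a x) as [->|]; [contradiction|reflexivity].
  - destruct Hx as [->|Hx]; [congruence|]. rewrite (IH Hx). lra.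
Qed.

(** * Logarithms *)

Lemma ln2_pos : 0 < ln 2.
Proof. pose proof ln_lt_2. lra. Qed.

Lemma log2_mult x y : 0 < x -> 0 < y -> log2 (x * y) = log2 x + log2 y.
Proof.
  intros. unfold log2. rewrite ln_mult by assumption. field. pose proof ln2_pos; lra.
Qed.

Lemma log2_div x y : 0 < x -> 0 < y -> log2 (x / y) = log2 x - log2 y.
Proof.
  intros. unfold log2, Rdiv.
  rewrite ln_mult, ln_Rinv by (try apply Rinv_0_lt_compat; assumption).
  field. pose proof ln2_pos; lra.
Qed.

Lemma log2_pow2 n : log2 (2 ^ n) = INR n.
Proof. unfold log2. rewrite ln_pow by lra. field. pose proof ln2_pos; lra. Qed.

Lemma log2_le x y : 0 < x -> x <= y -> log2 x <= log2 y.
Proof.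
  intros Hx [Hxy| ->]; [|lra]. unfold log2, Rdiv.
  apply Rmult_le_compat_r; [left; apply Rinv_0_lt_compat, ln2_pos|].
  left; now apply ln_increasing.
Qed.

Lemma log2_le_linear x : 0 < x -> log2 x <= (x - 1) / ln 2.
Proof.
  intros Hx. unfold log2, Rdiv.
  apply Rmult_le_compat_r; [left; apply Rinv_0_lt_compat, ln2_pos|].
  pose proof (exp_ineq1_le (ln x)) as H. rewrite exp_ln in H by assumption. lra.
Qed.

(** Jensen's inequality through the tangent of the logarithm at 1. Submodularity and the bound by
    the logarithm of the range both reduce to it, with [a] a ratio of fibre sizes. *)
Lemma sum_log2_nonpos {A} (l : list A) (a : A -> R) :
  (forall w, In w l -> 0 < a w) -> sumf l a <= INR (length l) ->
  sumf l (fun w => log2 (a w)) <= 0.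
Proof.
  intros Hpos Hs.
  apply Rle_trans with (sumf l (fun w => / ln 2 * (a w - 1))).
  - apply sumf_le. intros w Hw. pose proof (log2_le_linear (a w) (Hpos w Hw)). unfold Rdiv in *. lra.
  - rewrite sumf_scal, sumf_minus, sumf_const.
    pose proof (Rinv_0_lt_compat _ ln2_pos). nra.
Qed.

(** * Entropy on the uniform bit space *)

Lemma sumf_all_bits_S n f :
  sumf (all_bits (S n)) f = sumf (all_bits n) (fun w => f (false :: w) + f (true :: w)).
Proof.
  cbn [all_bits]. induction (all_bits n) as [|w l IH]; [reflexivity|].
  cbn [flat_map app]. rewrite !sumf_cons, IH. lra.
Qed.

Lemma in_all_bits N w : In w (all_bits N) <-> length w = N.
Proof.
  revert w. induction N as [|N IH]; intros w.
  - destruct w; simpl; intuition congruence.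
  - cbn [all_bits]. rewrite in_flat_map. split.
    + intros (v & Hv & Hw). apply IH in Hv. simpl in Hw. destruct Hw as [<-|[<-|[]]]; simpl; lia.
    + destruct w as [|b w]; simpl; [discriminate|]. intros H.
      exists w. split; [apply IH; lia|]. destruct b; auto.
Qed.

Lemma INR_length_all_bits N : INR (length (all_bits N)) = 2 ^ N.
Proof.
  rewrite <- (Rmult_1_r (INR _)), <- sumf_const.
  induction N as [|N IH]; [cbn; lra|].
  rewrite sumf_all_bits_S, (sumf_plus (all_bits N) (fun _ => 1) (fun _ => 1)), IH. simpl; lra.
Qed.

Lemma NoDup_all_bits N : NoDup (all_bits N).
Proof.
  induction N as [|N IH]; cbn [all_bits]; [repeat constructor; simpl; tauto|].
  induction IH as [|w l Hw _ IH]; cbn [flat_map app]; [constructor|].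
  assert (K : forall b, ~ In (b :: w) (flat_map (fun w => [false :: w; true :: w]) l)).
  { intros b Hb. apply in_flat_map in Hb as (v & Hv & Hb).
    simpl in Hb. destruct Hb as [Hb|[Hb|[]]]; congruence. }
  constructor; [intros [Hb|Hb]; [discriminate|now apply K in Hb]|].
  constructor; [apply K|exact IH].
Qed.

Lemma pow2_pos N : 0 < 2 ^ N.
Proof. apply pow_lt; lra. Qed.

Definition same {T} (d : dec T) (x y : T) : R := if d x y then 1 else 0.

Lemma same_nonneg {T} (d : dec T) x y : 0 <= same d x y.
Proof. unfold same. destruct (d x y); lra. Qed.

Lemma same_refl {T} (d : dec T) x : same d x x = 1.
Proof. unfold same. destruct (d x x); congruence. Qed.

(** The size of the fibre of [f] through [w], kept real so that it can be expanded as a sum; divided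
    by [2 ^ N] it is the probability of the value [f w]. *)
Definition kcard {T} (d : dec T) N (f : list bool -> T) (w : list bool) : R :=
  sumf (all_bits N) (fun w' => same d (f w') (f w)).

Lemma entropy_kcard {T} (d : dec T) N f :
  entropy d N f = - (sumf (all_bits N) (fun w => log2 (kcard d N f w / 2 ^ N)) / 2 ^ N).
Proof.
  unfold entropy, prob. do 2 f_equal. apply sumf_ext. intros w _. do 2 f_equal.
  rewrite <- sumf_b2r. apply sumf_ext. intros w' _. unfold same. now destruct (d _ _).
Qed.

Lemma kcard_ge1 {T} (d : dec T) N f w : In w (all_bits N) -> 1 <= kcard d N f w.
Proof.
  intros Hw. unfold kcard.
  rewrite <- (sumf_single dLB (all_bits N) w 1) by (auto using NoDup_all_bits).
  apply sumf_le. intros v _. destruct (dLB v w) as [->|].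
  - rewrite same_refl; lra.
  - apply same_nonneg.
Qed.

Lemma kcard_eq {T} (d : dec T) N f w w' : f w = f w' -> kcard d N f w = kcard d N f w'.
Proof. unfold kcard. now intros ->. Qed.

Lemma kcard_div_pos {T} (d : dec T) N f w : In w (all_bits N) -> 0 < kcard d N f w / 2 ^ N.
Proof.
  intros Hw. pose proof (kcard_ge1 d N f w Hw). apply Rdiv_lt_0_compat; [lra|apply pow2_pos].
Qed.

Definition determines {A B} N (f : list bool -> A) (g : list bool -> B) : Prop :=
  forall w w', In w (all_bits N) -> In w' (all_bits N) -> f w = f w' -> g w = g w'.

(** Each fibre of [f] lies inside a fibre of [g], so the comparison is termwise. *)
Lemma entropy_mono {A B} (da : dec A) (db : dec B) N f g :
  determines N f g -> entropy db N g <= entropy da N f.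
Proof.
  intros H. rewrite !entropy_kcard. apply Ropp_le_contravar.
  apply Rmult_le_compat_r; [left; apply Rinv_0_lt_compat, pow2_pos|].
  apply sumf_le. intros w Hw. apply log2_le; [now apply kcard_div_pos|].
  apply Rmult_le_compat_r; [left; apply Rinv_0_lt_compat, pow2_pos|].
  apply sumf_le. intros v Hv. unfold same.
  destruct (da (f v) (f w)) as [e|], (db (g v) (g w)) as [e'|n']; try lra.
  exfalso. apply n'. now apply H.
Qed.

Lemma entropy_eq {A B} (da : dec A) (db : dec B) N f g :
  determines N f g -> determines N g f -> entropy da N f = entropy db N g.
Proof. intros. apply Rle_antisym; now apply entropy_mono. Qed.

Lemma entropy_const_class {T} (d : dec T) N f c :
  0 < c -> (forall w, In w (all_bits N) -> kcard d N f w = c) ->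
  entropy d N f = INR N - log2 c.
Proof.
  intros Hc H. rewrite entropy_kcard.
  rewrite (sumf_ext _ _ (fun _ => log2 c - INR N)).
  - rewrite sumf_const, INR_length_all_bits. field. apply Rgt_not_eq, pow2_pos.
  - intros w Hw. rewrite (H w Hw), log2_div, log2_pow2; auto using pow2_pos.
Qed.

Lemma entropy_inj {T} (d : dec T) N f :
  (forall w w', In w (all_bits N) -> In w' (all_bits N) -> f w = f w' -> w = w') ->
  entropy d N f = INR N.
Proof.
  intros H. rewrite (entropy_const_class d N f 1); [unfold log2; rewrite ln_1; lra|lra|].
  intros w Hw. unfold kcard.
  rewrite <- (sumf_single dLB (all_bits N) w 1) by (auto using NoDup_all_bits).
  apply sumf_ext. intros v Hv. unfold same.
  destruct (d _ _) as [e|n], (dLB v w) as [e'|n']; try reflexivity.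
  - exfalso. auto.
  - exfalso. apply n. now subst.
Qed.

Lemma entropy_trivial {T} (d : dec T) N f :
  (forall w w', In w (all_bits N) -> In w' (all_bits N) -> f w = f w') ->
  entropy d N f = 0.
Proof.
  intros H. rewrite (entropy_const_class d N f (2 ^ N)); [rewrite log2_pow2; lra|apply pow2_pos|].
  intros w Hw. unfold kcard. rewrite <- INR_length_all_bits, <- (Rmult_1_r (INR _)), <- sumf_const.
  apply sumf_ext. intros v Hv. rewrite (H v w Hv Hw). apply same_refl.
Qed.

(** The words with [P w = 1] all lie in one fibre of [f], whose size is the common denominator. *)
Lemma sum_inv_kcard_le1 {T} (d : dec T) N (f : list bool -> T) (P : list bool -> R) :
  (forall w, In w (all_bits N) -> P w = 0 \/ P w = 1) ->
  (forall w w', In w (all_bits N) -> In w' (all_bits N) -> P w = 1 -> P w' = 1 -> f w = f w') ->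
  sumf (all_bits N) (fun w => P w / kcard d N f w) <= 1.
Proof.
  intros H01 HP.
  destruct (classic (exists w0, In w0 (all_bits N) /\ P w0 = 1)) as [(w0 & Hw0 & E0)|Hno].
  - pose proof (kcard_ge1 d N f w0 Hw0) as Hk.
    apply Rle_trans with (sumf (all_bits N) (fun w => / kcard d N f w0 * same d (f w) (f w0))).
    + apply sumf_le. intros w Hw. destruct (H01 w Hw) as [E|E]; rewrite E.
      * unfold Rdiv. rewrite Rmult_0_l. apply Rmult_le_pos; [|apply same_nonneg].
        left. apply Rinv_0_lt_compat. lra.
      * rewrite (HP w w0) by assumption. rewrite (kcard_eq d N f w w0), same_refl by (now apply HP). lra.
    + rewrite sumf_scal. fold (kcard d N f w0). rewrite Rinv_l; lra.
  - rewrite (sumf_ext _ _ (fun _ => 0)), sumf_const; [lra|].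
    intros w Hw. destruct (H01 w Hw) as [->|E]; [lra|]. exfalso; eauto.
Qed.

(** Jensen's inequality for the ratio of fibre sizes [f * g / ((f, g) * h)], whose sum over all
    words must be at most [2 ^ N]. Letting [k] be any function of the pair spares its users a
    re-encoding of the joint variable. *)
Lemma entropy_submodular {A B C D} (da : dec A) (db : dec B) (dc : dec C) (dd : dec D) N f g h k :
  determines N f h -> determines N g h -> determines N (fun w => (f w, g w)) k ->
  entropy dd N k + entropy dc N h <= entropy da N f + entropy db N g.
Proof.
  intros Hf Hg Hk.
  pose proof (entropy_mono (pair_dec da db) dd N _ _ Hk) as Hle.
  set (dp := pair_dec da db) in *. set (p := fun w => (f w, g w)) in *.
  cut (entropy dp N p + entropy dc N h <= entropy da N f + entropy db N g); [lra|].
  clear Hle Hk k.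
  assert (Hlog : sumf (all_bits N) (fun w => log2 (kcard da N f w * kcard db N g w
                   / (kcard dp N p w * kcard dc N h w))) <= 0).
  { apply sum_log2_nonpos.
    - intros w Hw.
      pose proof (kcard_ge1 da N f w Hw). pose proof (kcard_ge1 db N g w Hw).
      pose proof (kcard_ge1 dp N p w Hw). pose proof (kcard_ge1 dc N h w Hw).
      apply Rdiv_lt_0_compat; apply Rmult_lt_0_compat; lra.
    (* The two numerators become sums over [u] and [v]. In each nonzero term [h] takes the same
       value at [u], [v] and [w], so its denominator may be moved from [w] to [u]. *)
    - apply Rle_trans with (sumf (all_bits N) (fun w => sumf (all_bits N) (fun u =>
        sumf (all_bits N) (fun v => same dc (h v) (h u) / kcard dc N h u
           * (same da (f u) (f w) * same db (g v) (g w) / kcard dp N p w))))).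
      + apply sumf_le. intros w Hw.
        pose proof (kcard_ge1 dp N p w Hw) as Hpw. pose proof (kcard_ge1 dc N h w Hw) as Hhw.
        unfold kcard at 1 2.
        replace (sumf _ _ * sumf _ _ / _) with
          (/ (kcard dp N p w * kcard dc N h w) *
             sumf (all_bits N) (fun u => sumf (all_bits N) (fun v =>
                 same da (f u) (f w) * same db (g v) (g w)))).
        2:{ rewrite (sumf_ext _ _ (fun u => sumf (all_bits N) (fun v => same db (g v) (g w)) * same da (f u) (f w))).
            2:{ intros u _. rewrite sumf_scal. ring. }
            rewrite sumf_scal. unfold Rdiv. ring. }
        rewrite <- sumf_scal. apply sumf_le. intros u Hu.
        rewrite <- sumf_scal. apply sumf_le. intros v Hv.
        unfold same at 1 2 4 5.
        destruct (da (f u) (f w)) as [e1|]; [destruct (db (g v) (g w)) as [e2|]|].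
        * apply Hf in e1; auto. apply Hg in e2; auto.
          rewrite (kcard_eq dc N h u w), e1, e2, same_refl by assumption.
          right. field. lra.
        * right. unfold Rdiv. ring.
        * right. unfold Rdiv. ring.
      (* Summed in the order [w], [v], [u]: the sum over [w] is at most 1 because [u] and [v] fix
         the value of the pair, the sum over [v] is then at most 1, and [u] runs over [2 ^ N]
         words. *)
      + rewrite sumf_swap, <- (Rmult_1_r (INR _)), <- sumf_const. apply sumf_le. intros u Hu.
        pose proof (kcard_ge1 dc N h u Hu) as Hhu.
        rewrite sumf_swap.
        apply Rle_trans with (sumf (all_bits N) (fun v => / kcard dc N h u * same dc (h v) (h u))).
        * apply sumf_le. intros v Hv. rewrite sumf_scal.
          apply Rle_trans with (same dc (h v) (h u) / kcard dc N h u * 1); [|unfold Rdiv; lra].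
          apply Rmult_le_compat_l.
          -- apply Rmult_le_pos; [apply same_nonneg|]. left; apply Rinv_0_lt_compat; lra.
          -- apply sum_inv_kcard_le1.
             ++ intros w _. unfold same. destruct (da _ _), (db _ _); lra.
             ++ intros w w' _ _. unfold same, p.
                destruct (da (f u) (f w)), (db (g v) (g w)), (da (f u) (f w')), (db (g v) (g w')); intros; try lra.
                congruence.
        * rewrite sumf_scal. fold (kcard dc N h u). rewrite Rinv_l; lra. }
  rewrite (sumf_ext _ _ (fun w => (log2 (kcard da N f w / 2 ^ N) + log2 (kcard db N g w / 2 ^ N))
     - (log2 (kcard dp N p w / 2 ^ N) + log2 (kcard dc N h w / 2 ^ N)))) in Hlog.
  - rewrite sumf_minus, !sumf_plus in Hlog. rewrite !entropy_kcard.
    pose proof (Rinv_0_lt_compat _ (pow2_pos N)). unfold Rdiv in *. nra.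
  - intros w Hw.
    pose proof (kcard_ge1 da N f w Hw). pose proof (kcard_ge1 db N g w Hw).
    pose proof (kcard_ge1 dp N p w Hw). pose proof (kcard_ge1 dc N h w Hw).
    pose proof (pow2_pos N).
    rewrite !log2_div, !log2_mult by (try apply Rmult_lt_0_compat; lra). lra.
Qed.

(** Submodularity with [h] constant. *)
Lemma entropy_subadditive {A B C} (da : dec A) (db : dec B) (dc : dec C) N f g k :
  determines N (fun w => (f w, g w)) k ->
  entropy dc N k <= entropy da N f + entropy db N g.
Proof.
  intros H.
  pose proof (entropy_submodular da db dN dc N f g (fun _ => 0%nat) k) as K.
  rewrite (entropy_trivial dN N (fun _ => 0%nat)) in K by reflexivity.
  assert (entropy dc N k + 0 <= entropy da N f + entropy db N g); [|lra].
  apply K; auto; now intros w w' _ _ _.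
Qed.

(** Jensen's inequality again: summing [1 / kcard] over one fibre gives 1, so over all words it is
    at most the number of listed values. *)
Lemma entropy_le_log_range {T} (d : dec T) N (f : list bool -> T) (l : list T) :
  (forall w, In w (all_bits N) -> In (f w) l) ->
  entropy d N f <= log2 (INR (length l)).
Proof.
  intros Hl.
  assert (HlR : 0 < INR (length l)).
  { assert (exists w, In w (all_bits N)) as [w Hw]
      by (exists (repeat false N); apply in_all_bits, repeat_length).
    apply Hl in Hw. destruct l; [contradiction|]. apply lt_0_INR; simpl; lia. }
  pose proof (pow2_pos N) as HN.
  assert (K : sumf (all_bits N) (fun w => log2 (2 ^ N / (kcard d N f w * INR (length l)))) <= 0).
  { apply sum_log2_nonpos.
    - intros w Hw. pose proof (kcard_ge1 d N f w Hw).
      apply Rdiv_lt_0_compat; [lra|]. apply Rmult_lt_0_compat; lra.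
    - rewrite INR_length_all_bits.
      rewrite (sumf_ext _ _ (fun w => 2 ^ N / INR (length l) * (1 / kcard d N f w))).
      2:{ intros w Hw. pose proof (kcard_ge1 d N f w Hw). field. lra. }
      rewrite sumf_scal.
      assert (K : sumf (all_bits N) (fun w => 1 / kcard d N f w) <= INR (length l)).
      { apply Rle_trans with (sumf (all_bits N) (fun w => sumf l (fun x => same d (f w) x / kcard d N f w))).
        - apply sumf_le. intros w Hw. pose proof (kcard_ge1 d N f w Hw).
          assert (0 < / kcard d N f w) by (apply Rinv_0_lt_compat; lra).
          rewrite (sumf_ext _ _ (fun x => / kcard d N f w * same d (f w) x))
            by (intros; unfold Rdiv; lra).
          rewrite sumf_scal.
          assert (Hi : 1 <= sumf l (fun x => same d (f w) x)).
          { destruct (in_split _ _ (Hl w Hw)) as (l1 & l2 & ->).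
            rewrite sumf_app, sumf_cons, same_refl.
            pose proof (sumf_nonneg l1 (fun x => same d (f w) x) (fun a _ => same_nonneg _ _ _)).
            pose proof (sumf_nonneg l2 (fun x => same d (f w) x) (fun a _ => same_nonneg _ _ _)). lra. }
          unfold Rdiv. rewrite (Rmult_comm 1). apply Rmult_le_compat_l; [lra|exact Hi].
        - rewrite sumf_swap, <- (Rmult_1_r (INR _)), <- sumf_const. apply sumf_le. intros x _.
          apply sum_inv_kcard_le1.
          + intros w _. unfold same. destruct (d _ _); lra.
          + intros w w' _ _. unfold same. destruct (d (f w) x), (d (f w') x); intros; try lra. congruence. }
      apply Rle_trans with (2 ^ N / INR (length l) * INR (length l)); [|right; field; lra].
      apply Rmult_le_compat_l; [|exact K]. apply Rlt_le, Rdiv_lt_0_compat; lra. }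
  rewrite (sumf_ext _ _ (fun w => - log2 (kcard d N f w / 2 ^ N) - log2 (INR (length l)))) in K.
  - rewrite sumf_minus, sumf_const, INR_length_all_bits in K.
    rewrite (sumf_ext _ _ (fun w => (-1) * log2 (kcard d N f w / 2 ^ N))) in K by (intros; lra).
    rewrite sumf_scal in K. rewrite entropy_kcard.
    apply Rmult_le_reg_r with (2 ^ N); [lra|].
    unfold Rdiv. rewrite Ropp_mult_distr_l, Rmult_assoc, Rinv_l by lra. lra.
  - intros w Hw. pose proof (kcard_ge1 d N f w Hw).
    rewrite !log2_div, log2_mult by (try apply Rmult_lt_0_compat; lra). lra.
Qed.

(* Fano-type bound: only the words outside the good event have to be described in full. *)
Lemma entropy_fano {A B} (da : dec A) (db : dec B) N (Y : list bool -> A) (Z : list bool -> B)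
  (good : list bool -> bool) delta :
  (forall w w', In w (all_bits N) -> In w' (all_bits N) ->
     good w = true -> good w' = true -> Y w = Y w' -> Z w = Z w') ->
  prob N good >= 1 - delta ->
  entropy db N Z <= entropy da N Y + (2 + delta * INR N).
Proof.
  intros HZ Hp.
  pose proof (pow2_pos N) as HN.
  (* Together with [Y], the variable [U] determines [Z]. The prefix [true] keeps the record of a bad
     word apart from the empty list, even when [N = 0]. *)
  set (U := fun w => if good w then [] else true :: w).
  assert (H1 : entropy db N Z <= entropy da N Y + entropy dLB N U).
  { apply entropy_subadditive. intros w w' Hw Hw' E. injection E as EY EU. unfold U in EU.
    destruct (good w) eqn:G, (good w') eqn:G'; try discriminate; auto.
    injection EU as ->. reflexivity. }
  cut (entropy dLB N U <= 2 + delta * INR N); [lra|].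
  rewrite entropy_kcard.
  set (s := sumf (all_bits N) (fun w => b2r (good w))).
  assert (Hs : 0 <= s <= 2 ^ N).
  { unfold s. split; [apply sumf_nonneg; intros; apply b2r_nonneg|].
    rewrite <- INR_length_all_bits, <- (Rmult_1_r (INR _)), <- sumf_const.
    apply sumf_le; intros w _; destruct (good w); simpl; lra. }
  assert (Hb : 2 ^ N - s <= delta * 2 ^ N).
  { unfold prob in Hp. rewrite <- sumf_b2r in Hp. fold s in Hp.
    assert (1 - delta <= s / 2 ^ N) as Hp' by lra.
    apply (Rmult_le_compat_r (2 ^ N)) in Hp'; [|lra].
    unfold Rdiv in Hp'. rewrite Rmult_assoc, Rinv_l in Hp' by lra. lra. }
  (* A bad word costs at most [N] bits. The [s] good words share one fibre, and each costs at most
     [2 * (2 ^ N / s)] because [1 / ln 2] is below 2; their total is at most [2 * 2 ^ N]. *)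
  assert (K : sumf (all_bits N) (fun w => - log2 (kcard dLB N U w / 2 ^ N))
              <= sumf (all_bits N) (fun w => INR N * (1 - b2r (good w)) + 2 * 2 ^ N * (b2r (good w) / s))).
  { apply sumf_le. intros w Hw. pose proof (kcard_ge1 dLB N U w Hw) as Hk.
    destruct (good w) eqn:G; cbn [b2r].
    - assert (E : kcard dLB N U w = s).
      { unfold kcard, s. apply sumf_ext. intros v _. unfold U, same. rewrite G.
        destruct (good v); destruct (dLB _ _); simpl; congruence. }
      rewrite E in *. replace (- log2 (s / 2 ^ N)) with (log2 (2 ^ N / s))
        by (rewrite !log2_div by lra; lra).
      assert (Hpos : 0 < 2 ^ N / s) by (apply Rdiv_lt_0_compat; lra).
      pose proof (log2_le_linear _ Hpos) as Hl.
      assert (Hge : 0 <= 2 ^ N / s - 1).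
      { apply Rmult_le_reg_r with s; [lra|]. replace ((2 ^ N / s - 1) * s) with (2 ^ N - s) by (field; lra). lra. }
      assert (H2 : (2 ^ N / s - 1) / ln 2 <= (2 ^ N / s - 1) * 2).
      { apply Rmult_le_compat_l; [assumption|].
        pose proof ln_lt_2 as L2. pose proof (Rinv_le_contravar (/ 2) (ln 2)) as L3.
        rewrite Rinv_inv in L3. apply L3; lra. }
      replace (2 * 2 ^ N * (1 / s)) with (2 * (2 ^ N / s)) by (field; lra). lra.
    - rewrite log2_div, log2_pow2 by lra.
      assert (0 <= log2 (kcard dLB N U w)).
      { replace 0 with (log2 1) by (unfold log2; rewrite ln_1; lra). apply log2_le; lra. }
      unfold Rdiv. lra. }
  rewrite sumf_plus, !sumf_scal, sumf_minus, sumf_const, INR_length_all_bits in K.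
  rewrite (sumf_ext _ (fun w => b2r (good w) / s) (fun w => / s * b2r (good w))) in K by (intros; unfold Rdiv; lra).
  rewrite sumf_scal in K. fold s in K.
  (* If no word is good then [s = 0], and the product is 0 whatever value [/ 0] has. *)
  assert (Hss : / s * s <= 1).
  { destruct (Req_dec s 0) as [->|]; [lra|]. rewrite Rinv_l; lra. }
  rewrite (sumf_ext _ _ (fun w => (-1) * log2 (kcard dLB N U w / 2 ^ N))), sumf_scal in K by (intros; lra).
  apply Rmult_le_reg_r with (2 ^ N); [lra|].
  unfold Rdiv. rewrite Ropp_mult_distr_l, Rmult_assoc, Rinv_l by lra.
  pose proof (Rmult_le_compat_l _ _ _ (pos_INR N) Hb) as M1.
  assert (M2 : 2 * 2 ^ N * (/ s * s) <= 2 * 2 ^ N * 1) by (apply Rmult_le_compat_l; lra).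
  lra.
Qed.

(** * Coordinate projections *)

Definition sub (S : nat -> bool) (N : nat) (w : list bool) : list bool :=
  map (fun p => nth p w false) (filter S (seq 0 N)).

Lemma sub_eq S N w w' :
  sub S N w = sub S N w' <->
  forall p, (p < N)%nat -> S p = true -> nth p w false = nth p w' false.
Proof.
  unfold sub. split.
  - intros H p Hp HS. apply (ext_in_map H). apply filter_In. split; [apply in_seq; lia|exact HS].
  - intros H. apply map_ext_in. intros p Hp. apply filter_In in Hp as [Hp HS].
    apply in_seq in Hp. apply H; [lia|exact HS].
Qed.

Lemma filter_map_swap {A B} (P : B -> bool) (f : A -> B) l :
  filter P (map f l) = map f (filter (fun a => P (f a)) l).
Proof.
  induction l as [|a l IH]; [reflexivity|]. cbn. destruct (P (f a)); cbn; now rewrite IH.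
Qed.

Lemma sub_cons S N a w :
  sub S (Datatypes.S N) (a :: w) = (if S 0%nat then [a] else []) ++ sub (fun p => S (Datatypes.S p)) N w.
Proof.
  unfold sub. cbn [seq filter]. rewrite <- seq_shift, filter_map_swap.
  destruct (S 0%nat); cbn [map app nth]; now rewrite map_map.
Qed.

(** The coordinates outside [S] are free; the induction peels off the first coordinate of the
    word. *)
Lemma kcard_sub S N w :
  length w = N ->
  kcard dLB N (sub S N) w = 2 ^ length (filter (fun p => negb (S p)) (seq 0 N)).
Proof.
  unfold kcard. revert S w. induction N as [|N IH]; intros S w Hw.
  - cbn. lra.
  - destruct w as [|a w]; [discriminate|]. injection Hw as Hw.
    specialize (IH (fun p => S (Datatypes.S p)) w Hw).
    rewrite sumf_all_bits_S. cbn [seq filter]. rewrite <- seq_shift, filter_map_swap.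
    destruct (S 0%nat) eqn:E0; cbn [negb length]; rewrite length_map, <- ?tech_pow_Rmult, <- IH.
    + apply sumf_ext. intros v _. rewrite !sub_cons, E0. cbn [app]. unfold same.
      destruct a; repeat match goal with |- context [if ?c then _ else _] => destruct c end;
        try lra; congruence.
    + rewrite <- sumf_scal. apply sumf_ext. intros v _. rewrite !sub_cons, E0. cbn [app]. lra.
Qed.

Lemma entropy_sub S N :
  entropy dLB N (sub S N) = INR (length (filter S (seq 0 N))).
Proof.
  rewrite (entropy_const_class _ _ _ (2 ^ length (filter (fun p => negb (S p)) (seq 0 N)))).
  - rewrite log2_pow2. pose proof (filter_length S (seq 0 N)) as H.
    rewrite length_seq in H. apply (f_equal INR) in H. rewrite plus_INR in H. lra.
  - apply pow2_pos.
  - intros w Hw. apply kcard_sub. now apply in_all_bits.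
Qed.

Lemma word_ext (w w' : list bool) N :
  length w = N -> length w' = N -> (forall p, (p < N)%nat -> nth p w false = nth p w' false) -> w = w'.
Proof.
  intros H H' K. apply (nth_ext _ _ false false); [congruence|]. intros p Hp. apply K. lia.
Qed.

(* Each coordinate [p] contributes H(xi_p | L, earlier coordinates) on the right, and at least that
   much to every [sub (S i)] containing it, since there one conditions on fewer coordinates. *)
Lemma shearer {T} (d : dec T) N m t (S : nat -> nat -> bool) (L : list bool -> T) :
  (forall p, (p < N)%nat -> length (filter (fun i => S i p) (seq 0 m)) = t) ->
  INR t * (INR N - entropy d N L) <=
  sumf (seq 0 m) (fun i => entropy (pair_dec dLB d) N (fun w => (sub (S i) N w, L w)) - entropy d N L).
Proof.
  intros Ht.
  set (H := fun (S : nat -> bool) p => entropy (pair_dec dLB d) N (fun w => (sub S p w, L w))).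
  set (all := fun _ : nat => true).
  (* Induction on the length of the prefix: the inequality is proved for the first [p] coordinates
     in place of all [N]. *)
  assert (K : forall p, (p <= N)%nat ->
    INR t * (H all p - entropy d N L) <= sumf (seq 0 m) (fun i => H (S i) p - entropy d N L)).
  { induction p as [|p IH]; intros Hp.
    - assert (E : forall S, H S 0%nat = entropy d N L).
      { intros S'. apply entropy_eq; intros w w' _ _ E; [now injection E|unfold sub; cbn; congruence]. }
      rewrite E, (sumf_ext _ _ (fun _ => 0)), sumf_const; [lra|]. intros i _. rewrite E. lra.
    - specialize (IH ltac:(lia)).
      assert (Hstep : sumf (seq 0 m) (fun i => b2r (S i p) * (H all (Datatypes.S p) - H all p))
                 <= sumf (seq 0 m) (fun i => H (S i) (Datatypes.S p) - H (S i) p)).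
      { apply sumf_le. intros i _. destruct (S i p) eqn:E; cbn [b2r].
        - rewrite Rmult_1_l.
          assert (H all (Datatypes.S p) + H (S i) p <= H (S i) (Datatypes.S p) + H all p); [|lra].
          (* The prefix seen through [S i], extended by [p], and the full prefix of length [p] have
             the shorter view as common part and together give the full prefix of length [p + 1]. *)
          apply entropy_submodular; intros w w' _ _ E'; injection E'.
          + intros EL ES. f_equal; [|exact EL]. rewrite sub_eq in *. intros; apply ES; auto; lia.
          + intros EL ES. f_equal; [|exact EL]. rewrite sub_eq in *. intros; apply ES; auto; lia.
          + intros _ ES EL ES'. f_equal; [|exact EL]. rewrite sub_eq in *. intros q Hq _.
            destruct (Nat.eq_dec q p) as [->|]; [apply ES'; auto; lia|apply ES; auto; lia].
        - assert (H (S i) p <= H (S i) (Datatypes.S p)); [|lra].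
          apply entropy_mono. intros w w' _ _ E'; injection E'.
          intros EL ES. f_equal; [|exact EL]. rewrite sub_eq in *. intros; apply ES; auto; lia. }
      rewrite (sumf_ext _ _ (fun i => (H all (Datatypes.S p) - H all p) * b2r (S i p))) in Hstep
        by (intros; lra).
      rewrite sumf_scal, sumf_b2r, Ht in Hstep by lia.
      rewrite sumf_minus in Hstep, IH |- *. lra. }
  specialize (K N (Nat.le_refl N)).
  (* With all coordinates included, the pair contains the whole word and has entropy [N]. *)
  replace (INR N) with (H all N); [exact K|].
  apply entropy_inj. intros w w' Hw Hw' E. injection E as E _.
  rewrite sub_eq in E. apply in_all_bits in Hw, Hw'. apply (word_ext w w' N); auto.
Qed.

(** * The hypergraph source *)

Definition meetsE (A e : list nat) : bool := existsb (fun i => inE i e) A.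
(** Bit [p] is stored at position [j * length E + k], so its hyperedge is recovered as
    [p mod length E]. *)
Definition meets (E : hypergraph) (A : list nat) (p : nat) : bool :=
  meetsE A (nth (p mod length E) E []).

Lemma map_add_seq a b l : map (fun k => (a + k)%nat) (seq b l) = seq (a + b) l.
Proof.
  revert b. induction l as [|l IH]; intros b; cbn [seq map]; [reflexivity|].
  now rewrite IH, Nat.add_succ_r.
Qed.

Lemma filter_seq_blocks (E : hypergraph) n (Q : list nat -> bool) :
  filter (fun p => Q (nth (p mod length E) E [])) (seq 0 (n * length E)) =
  flat_map (fun j => map (fun k => (j * length E + k)%nat)
     (filter (fun k => Q (nth k E [])) (seq 0 (length E)))) (seq 0 n).
Proof.
  induction n as [|n IH]; [reflexivity|].
  rewrite seq_S, flat_map_app, <- IH. cbn [Nat.add flat_map]. rewrite app_nil_r.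
  replace (S n * length E)%nat with (n * length E + length E)%nat by lia.
  rewrite seq_app, filter_app. f_equal. cbn [Nat.add].
  replace (seq (n * length E) (length E)) with (map (fun k => (n * length E + k)%nat) (seq 0 (length E))).
  - rewrite filter_map_swap. f_equal. apply filter_ext_in. intros k Hk. apply in_seq in Hk.
    do 2 f_equal. rewrite Nat.add_comm, Nat.Div0.mod_add. apply Nat.mod_small. lia.
  - now rewrite map_add_seq, Nat.add_0_r.
Qed.

(** Turns observations into coordinate projections, to which the entropy count and Shearer's
    inequality apply. *)
Lemma obs_sub E n i w : obs E n i w = sub (meets E [i]) (NN E n) w.
Proof.
  unfold sub, NN, meets. rewrite (filter_seq_blocks E n (meetsE [i])).
  unfold obs. induction (seq 0 n) as [|j l IH]; [reflexivity|].
  cbn [flat_map]. rewrite map_app, map_map, IH. f_equal.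
  unfold meetsE. cbn [existsb]. rewrite (filter_ext _ (fun k => inE i (nth k E []) || false)%bool); [reflexivity|].
  intros k. now rewrite orb_false_r.
Qed.

Lemma filter_nth_seq {A} (Q : A -> bool) l x0 :
  length (filter (fun k => Q (nth k l x0)) (seq 0 (length l))) = length (filter Q l).
Proof.
  induction l as [|a l IH]; [reflexivity|].
  cbn [length seq filter nth]. rewrite <- seq_shift, filter_map_swap. cbn [nth].
  destruct (Q a); cbn [length]; rewrite length_map, IH; reflexivity.
Qed.

Lemma count_meets E n A :
  length (filter (meets E A) (seq 0 (NN E n))) = (n * length (filter (meetsE A) E))%nat.
Proof.
  unfold NN, meets. rewrite (filter_seq_blocks E n (meetsE A)).
  rewrite <- (length_seq n 0) at 2. induction (seq 0 n) as [|j l IH]; [reflexivity|].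
  cbn [flat_map]. rewrite length_app, length_map, IH, filter_nth_seq. reflexivity.
Qed.

Lemma obsA_eq E n A w w' :
  obsA E n A w = obsA E n A w' <->
  forall p, (p < NN E n)%nat -> meets E A p = true -> nth p w false = nth p w' false.
Proof.
  unfold obsA. split.
  - intros H p Hp HS. unfold meets, meetsE in HS. apply existsb_exists in HS as (i & Hi & HS).
    pose proof (ext_in_map H i Hi) as K. cbn beta in K. rewrite !obs_sub, sub_eq in K. apply K; [exact Hp|].
    unfold meets, meetsE. cbn. now rewrite HS.
  - intros H. apply map_ext_in. intros i Hi. rewrite !obs_sub, sub_eq. intros p Hp HS. apply H; [exact Hp|].
    unfold meets, meetsE in *. apply existsb_exists. exists i. split; [exact Hi|].
    cbn in HS. now rewrite orb_false_r in HS.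
Qed.

Lemma entropy_obsA E n A :
  entropy dLLB (NN E n) (obsA E n A) = INR n * INR (length (filter (meetsE A) E)).
Proof.
  rewrite <- mult_INR, <- count_meets, <- entropy_sub.
  apply entropy_eq; intros w w' _ _; rewrite obsA_eq, sub_eq; auto.
Qed.

Lemma HA_count E A : HA E A = INR (length (filter (meetsE A) E)).
Proof. unfold HA. rewrite entropy_obsA. simpl. lra. Qed.

Lemma inE_iff i e : inE i e = true <-> In i e.
Proof.
  unfold inE. rewrite existsb_exists. split.
  - intros (x & Hx & E). apply Nat.eqb_eq in E. now subst.
  - intros H. exists i. split; [exact H|apply Nat.eqb_refl].
Qed.

Lemma meetsE_iff A e : meetsE A e = true <-> exists i, In i A /\ In i e.
Proof.
  unfold meetsE. rewrite existsb_exists. split; intros (i & Hi & H); exists i; split; auto; now apply inE_iff.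
Qed.

Lemma edge_degree m t E e :
  well_formed m E -> uniform t E -> In e E ->
  length (filter (fun i => inE i e) (seq 0 m)) = t.
Proof.
  intros Hwf Hu He. unfold well_formed, uniform in *. rewrite Forall_forall in *.
  destruct (Hwf e He) as [Hnd Hlt]. rewrite Forall_forall in Hlt. rewrite <- (Hu e He).
  apply Permutation_length, NoDup_Permutation; [apply NoDup_filter, seq_NoDup|exact Hnd|].
  intros i. rewrite filter_In, inE_iff, in_seq. split; [tauto|]. intros Hi. pose proof (Hlt i Hi). split; [lia|exact Hi].
Qed.

(** Double counting of the pairs of a terminal and a hyperedge containing it. *)
Lemma sum_degrees m t E :
  well_formed m E -> uniform t E ->
  sumf (seq 0 m) (fun i => INR (length (filter (meetsE [i]) E))) = INR t * INR (length E).
Proof.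
  intros Hwf Hu.
  rewrite (sumf_ext _ _ (fun i => sumf E (fun e => b2r (meetsE [i] e)))) by (intros; now rewrite sumf_b2r).
  rewrite sumf_swap, (sumf_ext _ _ (fun _ => INR t)), sumf_const; [lra|].
  intros e He. rewrite sumf_b2r. f_equal. rewrite <- (edge_degree m t E e Hwf Hu He). f_equal.
  apply filter_ext. intros i. unfold meetsE. cbn. apply orb_false_r.
Qed.

Lemma coordinate_edge E n p : (p < NN E n)%nat -> In (nth (p mod length E) E []) E.
Proof.
  unfold NN. intros H. apply nth_In. apply Nat.mod_upper_bound. lia.
Qed.

Lemma coordinate_degree m t E n p :
  well_formed m E -> uniform t E -> (p < NN E n)%nat ->
  length (filter (fun i => meets E [i] p) (seq 0 m)) = t.
Proof.
  intros Hwf Hu Hp. rewrite <- (edge_degree m t E _ Hwf Hu (coordinate_edge E n p Hp)). f_equal.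
  apply filter_ext. intros i. unfold meets, meetsE. cbn. apply orb_false_r.
Qed.

Lemma meetsE_all m t E e :
  (1 <= t)%nat -> well_formed m E -> uniform t E -> In e E -> meetsE (seq 0 m) e = true.
Proof.
  intros Ht Hwf Hu He. pose proof (edge_degree m t E e Hwf Hu He) as H.
  destruct (filter (fun i => inE i e) (seq 0 m)) as [|i l] eqn:F; [simpl in H; lia|].
  assert (Hi : In i (filter (fun i => inE i e) (seq 0 m))) by (rewrite F; now left).
  apply filter_In in Hi as [Hi1 Hi2]. apply meetsE_iff. exists i. split; [exact Hi1|now apply inE_iff].
Qed.

Lemma filter_all_true {A} (P : A -> bool) l : (forall a, In a l -> P a = true) -> filter P l = l.
Proof.
  induction l as [|a l IH]; intros H; [reflexivity|]. cbn. rewrite (H a (or_introl eq_refl)), IH; auto.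
  intros; apply H; now right.
Qed.

Lemma HA_all m t E :
  (1 <= t)%nat -> well_formed m E -> uniform t E -> HA E (seq 0 m) = INR (length E).
Proof.
  intros. rewrite HA_count, filter_all_true; [reflexivity|]. intros. eapply meetsE_all; eauto.
Qed.

(** As [t] is at least 1, every bit is seen by some terminal. *)
Lemma XM_inj m t E n w w' :
  (1 <= t)%nat -> well_formed m E -> uniform t E ->
  In w (all_bits (NN E n)) -> In w' (all_bits (NN E n)) -> XM m E n w = XM m E n w' -> w = w'.
Proof.
  intros Ht Hwf Hu Hw Hw' H. unfold XM in H. rewrite obsA_eq in H. apply in_all_bits in Hw, Hw'.
  apply (word_ext w w' _ Hw Hw'). intros p Hp. apply H; [exact Hp|].
  eapply meetsE_all; eauto. eapply coordinate_edge; eauto.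
Qed.

(** * Omniscience *)

(** This is the entropy of the observation of terminal [i] at blocklength 1. *)
Definition degree (E : hypergraph) (i : nat) : R := INR (length (filter (meetsE [i]) E)).

Lemma inE_compl m B i : In i (compl m B) <-> (i < m)%nat /\ ~ In i B.
Proof.
  unfold compl. rewrite filter_In, in_seq, negb_true_iff, <- not_true_iff_false, inE_iff. intuition lia.
Qed.

Lemma NoDup_compl m B : NoDup (compl m B).
Proof. apply NoDup_filter, seq_NoDup. Qed.

Lemma compl_app_perm m B : NoDup B -> incl B (seq 0 m) -> Permutation (compl m B ++ B) (seq 0 m).
Proof.
  intros Hn Hi. apply NoDup_Permutation; [|apply seq_NoDup|].
  - apply NoDup_app; [apply NoDup_compl|exact Hn|]. intros i Hc. now apply inE_compl in Hc.
  - intros i. rewrite in_app_iff, inE_compl, in_seq.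
    destruct (in_dec Nat.eq_dec i B) as [Hb|]; [pose proof (proj1 (in_seq _ _ _) (Hi i Hb))|]; intuition lia.
Qed.

Lemma concat_singletons l : concat (map (fun i : nat => [i]) l) = l.
Proof. induction l as [|a l IH]; [reflexivity|]. cbn. now rewrite IH. Qed.

Lemma singletons_admissible m : (2 <= m)%nat -> admissible m (singletons m).
Proof.
  intros Hm. unfold singletons. repeat split.
  - now rewrite concat_singletons.
  - apply Forall_forall. intros B HB. apply in_map_iff in HB as (i & <- & _). discriminate.
  - now rewrite length_map, length_seq.
Qed.

Lemma sum_HA_singletons E l : sum_R (map (HA E) (map (fun i => [i]) l)) = sumf l (degree E).
Proof. rewrite map_map. apply sumf_ext. intros i _. apply HA_count. Qed.

(** The value of [Delta] at the singleton partition, hence the key capacity [MMI] under Type S. *)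
Definition rate (m t : nat) (E : hypergraph) : R := INR (t - 1) * INR (length E) / INR (m - 1).

Lemma Delta_singletons m t E :
  (2 <= m)%nat -> (1 <= t)%nat -> well_formed m E -> uniform t E ->
  Delta m E (singletons m) = rate m t E.
Proof.
  intros Hm Ht Hwf Hu. unfold Delta, singletons, rate.
  rewrite sum_HA_singletons, length_map, length_seq.
  unfold degree. rewrite (sum_degrees m t), (HA_all m t) by assumption.
  rewrite (minus_INR t) by exact Ht. cbn [INR]. f_equal. lra.
Qed.

(** A minimum is unique, which pins down the value chosen by [epsilon]. *)
Lemma MMI_rate m t E :
  (2 <= m)%nat -> (1 <= t)%nat -> well_formed m E -> uniform t E -> typeS m E ->
  MMI m E = rate m t E.
Proof.
  intros Hm Ht Hwf Hu HS. unfold MMI.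
  assert (Hex : is_min (fun x => exists P, admissible m P /\ Delta m E P = x) (rate m t E)).
  { rewrite <- (Delta_singletons m t E) by assumption. split.
    - exists (singletons m). split; [now apply singletons_admissible|reflexivity].
    - intros y (P & HP & <-). now apply HS. }
  destruct (epsilon_spec (inhabits 0) _ (ex_intro _ _ Hex)) as [H1 H2].
  destruct Hex as [H3 H4]. apply Rle_antisym; auto.
Qed.

(** The observations of [B] and of its complement together determine the source. What remains is the
    number of hyperedges missing the complement, that is, contained in [B]. *)
Lemma centropy_compl m t E B :
  (1 <= t)%nat -> well_formed m E -> uniform t E -> incl B (seq 0 m) ->
  centropy dLLB dLLB (NN E 1) (obsA E 1 B) (obsA E 1 (compl m B)) =
  INR (length E) - INR (length (filter (meetsE (compl m B)) E)).
Proof.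
  intros Ht Hwf Hu Hi. unfold centropy. rewrite entropy_obsA.
  rewrite (entropy_eq _ dLLB (NN E 1) _ (obsA E 1 (seq 0 m))).
  - change (entropy dLLB (NN E 1) (obsA E 1 (seq 0 m))) with (HA E (seq 0 m)).
    rewrite (HA_all m t) by assumption. simpl; lra.
  - intros w w' _ _ H. injection H as H1 H2. rewrite obsA_eq in *. intros p Hp Hm.
    apply meetsE_iff in Hm as (i & Him & Hie). apply in_seq in Him.
    destruct (in_dec Nat.eq_dec i B) as [Hb|Hb].
    + apply H1; [exact Hp|]. apply meetsE_iff. eauto.
    + apply H2; [exact Hp|]. apply meetsE_iff. exists i. rewrite inE_compl. intuition lia.
  - intros w w' _ _ H. rewrite obsA_eq in H.
    f_equal; rewrite obsA_eq; intros p Hp Hm; (apply H; [exact Hp|]);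
      apply meetsE_iff in Hm as (i & Him & Hie); apply meetsE_iff; exists i.
    + auto.
    + rewrite inE_compl in Him. rewrite in_seq. intuition lia.
Qed.

Definition co_rate (m t : nat) (E : hypergraph) (i : nat) : R := degree E i - rate m t E.

(* Type S applied to the partition consisting of the complement of [B] and the singletons of [B]. *)
Lemma co_rate_feasible m t E :
  (2 <= m)%nat -> (1 <= t)%nat -> well_formed m E -> uniform t E -> typeS m E ->
  co_feasible m E (co_rate m t E).
Proof.
  intros Hm Ht Hwf Hu HS B (Hn & Hi & Hne & Hlt).
  rewrite (centropy_compl m t) by assumption.
  change (sum_R (map (co_rate m t E) B)) with (sumf B (co_rate m t E)).
  unfold co_rate. rewrite sumf_minus, sumf_const.
  assert (HB : 0 < INR (length B)) by (destruct B; [congruence|apply lt_0_INR; simpl; lia]).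
  pose proof (compl_app_perm m B Hn Hi) as Hperm.
  specialize (HS (compl m B :: map (fun i => [i]) B)).
  rewrite (Delta_singletons m t) in HS by assumption.
  assert (Hadm : admissible m (compl m B :: map (fun i => [i]) B)).
  { repeat split.
    - cbn [concat]. now rewrite concat_singletons.
    - constructor.
      + intros E0. apply Permutation_length in Hperm. rewrite E0, length_seq in Hperm. simpl in Hperm. lia.
      + apply Forall_forall. intros A HA. apply in_map_iff in HA as (i & <- & _). discriminate.
    - cbn [length]. rewrite length_map. destruct B; [congruence|simpl; lia]. }
  specialize (HS Hadm). unfold Delta in HS. cbn [map sum_R fold_right length] in HS.
  change (fold_right Rplus 0) with sum_R in HS.
  rewrite sum_HA_singletons, length_map, HA_count, (HA_all m t) in HS by assumption.
  (* The partition has one block more than [B] has elements, so the denominator in [Delta] is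
     [length B]. *)
  rewrite Nat.sub_1_r, Nat.pred_succ in HS.
  apply (Rmult_le_compat_r (INR (length B))) in HS; [|lra].
  unfold Rdiv in HS. rewrite Rmult_assoc, Rinv_l in HS by lra. lra.
Qed.

Lemma sum_co_rate m t E :
  (2 <= m)%nat -> (1 <= t)%nat -> well_formed m E -> uniform t E ->
  sumf (seq 0 m) (co_rate m t E) = INR (m - t) / INR (m - 1) * INR (length E).
Proof.
  intros Hm Ht Hwf Hu. unfold co_rate, rate. rewrite sumf_minus, sumf_const, length_seq.
  unfold degree. rewrite (sum_degrees m t) by assumption.
  (* A hyperedge forces [t <= m], which makes the subtraction [m - t] exact; without hyperedges both
     sides vanish. *)
  destruct E as [|e E]; [cbn [length INR]; unfold Rdiv; ring|].
  assert (t <= m)%nat.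
  { rewrite <- (edge_degree m t _ e Hwf Hu (or_introl eq_refl)).
    etransitivity; [apply filter_length_le|]. now rewrite length_seq. }
  assert (2 <= INR m) by (apply (le_INR 2); exact Hm).
  rewrite !minus_INR by lia. cbn [INR]. field. lra.
Qed.

Lemma co_sums_min m t E :
  (2 <= m)%nat -> (1 <= t)%nat -> well_formed m E -> uniform t E -> typeS m E ->
  is_min (co_sums m E) (INR (m - t) / INR (m - 1) * INR (length E)).
Proof.
  intros Hm Ht Hwf Hu HS. split.
  - exists (co_rate m t E). split; [now apply co_rate_feasible|now apply sum_co_rate].
  - intros x (Rv & Hf & <-). change (sum_R (map Rv (seq 0 m))) with (sumf (seq 0 m) Rv).
    (* The constraint for all terminals but [i]: they jointly supply what [i] does not see. Summed
       over [i], each rate is counted [m - 1] times. *)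
    assert (K : forall i, In i (seq 0 m) ->
      INR (length E) - degree E i <= sumf (seq 0 m) Rv - Rv i).
    { intros i Hi. set (B := compl m [i]).
      assert (HiB : incl B (seq 0 m)) by (intros j Hj; apply inE_compl in Hj; apply in_seq; lia).
      assert (Hp : Permutation (i :: B) (seq 0 m)).
      { rewrite <- (compl_app_perm m [i]); [|repeat constructor; simpl; tauto|intros j [<-|[]]; exact Hi].
        apply Permutation_cons_append. }
      assert (HB : co_subset m B).
      { apply Permutation_length in Hp as Hl. rewrite length_seq in Hl. simpl in Hl.
        repeat split; [apply NoDup_compl|exact HiB| |lia]. intros E0. rewrite E0 in Hl. simpl in Hl. lia. }
      specialize (Hf B HB). rewrite (centropy_compl m t) in Hf by assumption.
      rewrite <- (sumf_perm _ _ Rv Hp), sumf_cons.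
      change (sum_R (map Rv B)) with (sumf B Rv) in Hf.
      replace (filter (meetsE (compl m B)) E) with (filter (meetsE [i]) E) in Hf;
        [unfold degree; lra|].
      apply filter_ext. intros e. apply eq_true_iff_eq. rewrite !meetsE_iff.
      apply in_seq in Hi.
      split; intros (j & Hj & He); exists j; (split; [|exact He]).
      - destruct Hj as [<-|[]]. apply inE_compl. split; [lia|]. unfold B. rewrite inE_compl. simpl. tauto.
      - apply inE_compl in Hj as [Hj Hn]. unfold B in Hn. rewrite inE_compl in Hn.
        simpl in *. destruct (Nat.eq_dec i j); tauto. }
    apply sumf_le in K. rewrite !sumf_minus, !sumf_const, length_seq in K.
    unfold degree in K. rewrite (sum_degrees m t) in K by assumption.
    rewrite <- (sum_co_rate m t) by assumption.
    unfold co_rate, rate, degree. rewrite sumf_minus, sumf_const, length_seq, (sum_degrees m t) by assumption.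
    assert (H2 : 2 <= INR m) by (apply (le_INR 2); exact Hm).
    rewrite !minus_INR by lia. cbn [INR].
    apply Rmult_le_reg_l with (INR m - 1); [lra|].
    apply Rle_trans with (INR m * INR (length E) - INR t * INR (length E)); [right; field; lra|lra].
Qed.

(** * Common information *)

Fixpoint lists_upto {A : Type} (l : list A) (k : nat) : list (list A) :=
  match k with
  | O => [[]]
  | S k => [] :: flat_map (fun a => map (cons a) (lists_upto l k)) l
  end.

Lemma in_lists_upto {A} (l : list A) k x : incl x l -> (length x <= k)%nat -> In x (lists_upto l k).
Proof.
  revert x. induction k as [|k IH]; intros [|a x] Hi Hk; cbn in *; auto; [lia|].
  right. apply in_flat_map. exists a. split; [apply Hi; now left|].
  apply in_map, IH; [intros b Hb; apply Hi; now right|lia].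
Qed.

Lemma length_concat_ge (P : list (list nat)) B : In B P -> (length B <= length (concat P))%nat.
Proof.
  induction P as [|C P IH]; [easy|]. cbn [concat]. rewrite length_app.
  intros [->|H]; [lia|]. apply IH in H. lia.
Qed.

(** Blocks are nonempty and their concatenation has length [m], so neither the number of blocks nor
    the size of a block exceeds [m]. *)
Lemma admissible_finite m P :
  admissible m P -> In P (lists_upto (lists_upto (seq 0 m) m) m).
Proof.
  intros [[Hp Hne] _]. pose proof (Permutation_length Hp) as Hl. rewrite length_seq in Hl.
  apply in_lists_upto.
  - intros B HB. apply in_lists_upto; [|rewrite <- Hl; now apply length_concat_ge].
    intros i Hi. apply (Permutation_in _ Hp), in_concat. eauto.
  - rewrite <- Hl. clear Hl Hp. induction Hne as [|B P HB _ IH]; [simpl; lia|].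
    cbn [concat length]. rewrite length_app. destruct B; [congruence|]. simpl. lia.
Qed.

Lemma finite_max {A} (l : list A) (Q : A -> Prop) (f : A -> R) :
  (forall a, Q a -> In a l) -> (exists a, Q a) ->
  exists x, is_max (fun x => exists a, Q a /\ f a = x) x.
Proof.
  revert Q. induction l as [|a l IH]; intros Q Hl [a0 Ha0]; [destruct (Hl a0 Ha0)|].
  destruct (classic (exists b, (Q b /\ b <> a))) as [Hb|Hno].
  - destruct (IH (fun b => Q b /\ b <> a)) as (x & (b & [Qb _] & Eb) & Hx).
    + intros b [Qb Nb]. destruct (Hl b Qb); [congruence|assumption].
    + exact Hb.
    + destruct (classic (Q a /\ x < f a)) as [[Qa Hlt]|Hn].
      * exists (f a). split; [eauto|]. intros y (c & Qc & <-).
        destruct (classic (c = a)) as [->|]; [lra|]. apply Rle_trans with x; [apply Hx; eauto|lra].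
      * exists x. split; [eauto|]. intros y (c & Qc & <-).
        destruct (classic (c = a)) as [->|]; [|apply Hx; eauto].
        destruct (Rle_lt_dec (f a) x); [assumption|tauto].
  - exists (f a0). split; [eauto|]. intros y (c & Qc & <-).
    assert (forall b, Q b -> b = a) as K by (intros b Qb; apply NNPP; intro; eauto).
    rewrite (K c Qc), (K a0 Ha0). lra.
Qed.

(** Only finitely many lists represent partitions, so the maximum exists and [epsilon] attains
    it. *)
Lemma condMMI_max {T} (d : dec T) m E n L :
  (exists P, minimizer m E P) ->
  is_max (fun x => exists P, minimizer m E P /\ cDelta d m E n L P = x) (condMMI d m E n L).
Proof.
  intros H. unfold condMMI. apply epsilon_spec.
  apply (finite_max (lists_upto (lists_upto (seq 0 m) m) m)); [|exact H].
  intros P [HP _]. now apply admissible_finite.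
Qed.

Lemma singletons_minimizer m t E :
  (2 <= m)%nat -> (1 <= t)%nat -> well_formed m E -> uniform t E -> typeS m E ->
  minimizer m E (singletons m).
Proof.
  intros. split; [now apply singletons_admissible|].
  rewrite (MMI_rate m t), (Delta_singletons m t) by assumption. reflexivity.
Qed.

Lemma entropy_obsA_single {T} (d : dec T) E n i L :
  entropy (pair_dec dLLB d) (NN E n) (fun w => (obsA E n [i] w, L w)) =
  entropy (pair_dec dLB d) (NN E n) (fun w => (sub (meets E [i]) (NN E n) w, L w)).
Proof.
  apply entropy_eq; intros w w' _ _ H; apply pair_equal_spec in H as [H1 H2]; f_equal; auto;
    rewrite obsA_eq, sub_eq in *; auto.
Qed.

Lemma entropy_pair_XM {T} (d : dec T) m t E n L :
  (1 <= t)%nat -> well_formed m E -> uniform t E ->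
  entropy (pair_dec dLLB d) (NN E n) (fun w => (XM m E n w, L w)) = INR (NN E n).
Proof.
  intros. apply entropy_inj. intros w w' Hw Hw' E'. injection E' as E' _.
  eapply XM_inj; eauto.
Qed.

(** Since [XM] determines the word, its conditional entropy is [INR (NN E n)] minus the entropy of
    [L]. Shearer's inequality bounds the sum over the terminals by [t] times this, and [cDelta]
    subtracts one copy. *)
Lemma cDelta_singletons_ge {T} (d : dec T) m t E n L :
  (2 <= m)%nat -> (1 <= t)%nat -> well_formed m E -> uniform t E ->
  INR (t - 1) * (INR (NN E n) - entropy d (NN E n) L) <=
  INR (m - 1) * cDelta d m E n L (singletons m).
Proof.
  intros Hm Ht Hwf Hu.
  pose proof (shearer d (NN E n) m t (fun i => meets E [i]) L) as Hs.
  specialize (Hs (fun p Hp => coordinate_degree m t E n p Hwf Hu Hp)).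
  unfold cDelta, singletons. rewrite map_map, length_map, length_seq.
  unfold centropy. rewrite (entropy_pair_XM d m t) by assumption.
  match goal with |- context [sum_R (map ?f _)] =>
    change (sum_R (map f (seq 0 m))) with (sumf (seq 0 m) f);
    rewrite (sumf_ext (seq 0 m) f (fun i => entropy (pair_dec dLB d) (NN E n)
       (fun w => (sub (meets E [i]) (NN E n) w, L w)) - entropy d (NN E n) L))
      by (intros i _; now rewrite entropy_obsA_single)
  end.
  assert (2 <= INR m) by (apply (le_INR 2); exact Hm).
  rewrite !minus_INR by lia. cbn [INR].
  match goal with |- _ <= _ * (?a / _) => replace ((INR m - 1) * (a / (INR m - 1))) with a by (field; lra) end.
  lra.
Qed.

Lemma cDelta_inj {T} (d : dec T) m E n L P :
  (forall w w', In w (all_bits (NN E n)) -> In w' (all_bits (NN E n)) -> L w = L w' -> w = w') ->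
  cDelta d m E n L P = 0.
Proof.
  intros HL. unfold cDelta.
  assert (K : forall A, centropy dLLB d (NN E n) (obsA E n A) L = 0).
  { intros A. unfold centropy. rewrite !entropy_inj; [lra|exact HL|].
    intros w w' Hw Hw' H. injection H as _ H. auto. }
  unfold XM. rewrite K, (map_ext _ (fun _ => 0)) by (intros; apply K).
  change (sum_R (map (fun _ => 0) P)) with (sumf P (fun _ => 0)).
  rewrite sumf_const. unfold Rdiv. ring.
Qed.

Lemma is_CIW_inj {T} (d : dec T) m t E L :
  (2 <= m)%nat -> (1 <= t)%nat -> well_formed m E -> uniform t E -> typeS m E ->
  (forall n w w', In w (all_bits (NN E n)) -> In w' (all_bits (NN E n)) -> L n w = L n w' -> w = w') ->
  is_CIW d m E L.
Proof.
  intros Hm Ht Hwf Hu HS HL eps Heps. exists 0%nat. intros n _.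
  destruct (condMMI_max d m E n (L n)) as [(P & _ & <-) _].
  - exists (singletons m). now apply (singletons_minimizer m t).
  - rewrite cDelta_inj by apply HL. unfold Rdiv. rewrite Rmult_0_l, Rabs_R0. lra.
Qed.

Lemma INR_NN E n : INR (NN E n) = INR n * INR (length E).
Proof. apply mult_INR. Qed.

Lemma le_of_eps x y C : 0 <= C -> (forall eps, eps > 0 -> x <= y + C * eps) -> x <= y.
Proof.
  intros HC H. apply Rnot_lt_le. intros Hlt.
  (* This [eps] makes [C * eps] at most half of the gap; [C + 1] keeps the denominator nonzero when
     [C = 0]. *)
  assert (Hp : 0 < (x - y) / (2 * (C + 1))) by (apply Rdiv_lt_0_compat; lra).
  specialize (H _ Hp).
  assert (C * ((x - y) / (2 * (C + 1))) <= (x - y) / 2); [|lra].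
  apply Rle_trans with ((C + 1) * ((x - y) / (2 * (C + 1)))); [nra|right; field; lra].
Qed.

(** Kept generic in [T] to serve both numbers and pairs of a number and a transcript, that is, both
    [CIW_achievable] and [CI_achievable]. *)
Lemma CIW_rate_lower {T} (d : dec T) m t E L R0 :
  (2 <= m)%nat -> (2 <= t)%nat -> well_formed m E -> uniform t E -> typeS m E ->
  is_CIW d m E L ->
  (forall eps, eps > 0 -> eventually (fun n => entropy d (NN E n) (L n) / INR n <= R0 + eps)) ->
  INR (length E) <= R0.
Proof.
  intros Hm Ht Hwf Hu HS HL HR.
  (* The slack [m - 1] comes from the residual [condMMI], the further 1 from the rate of [L]. *)
  apply (le_of_eps _ _ (INR (m - 1) + 1)); [pose proof (pos_INR (m - 1)); lra|].
  intros eps Heps. destruct (HL eps Heps) as [N1 H1]. destruct (HR eps Heps) as [N2 H2].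
  set (n := (S (N1 + N2))%nat). specialize (H1 n ltac:(lia)). specialize (H2 n ltac:(lia)).
  assert (Hn : 0 < INR n) by (apply lt_0_INR; lia).
  destruct (condMMI_max d m E n (L n)) as [_ Hmax].
  { exists (singletons m). apply (singletons_minimizer m t); auto; lia. }
  pose proof (Hmax _ (ex_intro _ _ (conj (singletons_minimizer m t E Hm ltac:(lia) Hwf Hu HS) eq_refl))) as H3.
  pose proof (cDelta_singletons_ge d m t E n (L n) Hm ltac:(lia) Hwf Hu) as H4.
  assert (H5 : condMMI d m E n (L n) <= INR n * eps).
  { pose proof (Rle_abs (condMMI d m E n (L n) / INR n)) as Ha.
    apply Rmult_le_reg_r with (/ INR n); [now apply Rinv_0_lt_compat|].
    replace (INR n * eps * / INR n) with eps by (field; lra). unfold Rdiv in *. lra. }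
  assert (H6 : entropy d (NN E n) (L n) <= INR n * (R0 + eps)).
  { apply Rmult_le_reg_r with (/ INR n); [now apply Rinv_0_lt_compat|].
    replace (INR n * (R0 + eps) * / INR n) with (R0 + eps) by (field; lra). exact H2. }
  rewrite INR_NN in H4.
  assert (Hm1 : 1 <= INR (m - 1)) by (apply (le_INR 1); lia).
  assert (Ht1 : 1 <= INR (t - 1)) by (apply (le_INR 1); lia).
  assert (H7 : INR n * INR (length E) - entropy d (NN E n) (L n) <= INR (m - 1) * (INR n * eps)).
  { destruct (Rle_lt_dec 0 (INR n * INR (length E) - entropy d (NN E n) (L n))).
    - apply Rle_trans with (INR (m - 1) * cDelta d m E n (L n) (singletons m)); [nra|].
      apply Rmult_le_compat_l; lra.
    - assert (0 < INR (m - 1) * (INR n * eps)) by (repeat apply Rmult_lt_0_compat; lra). lra. }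
  apply Rmult_le_reg_l with (INR n); [exact Hn|]. lra.
Qed.

(* Junk value: the empty word off the image of [f]. *)
Definition finv {T} (d : dec T) N (f : list bool -> T) (y : T) : list bool :=
  match find (fun w => if d (f w) y then true else false) (all_bits N) with
  | Some w => w
  | None => []
  end.

Lemma finv_spec {T} (d : dec T) N f w :
  In w (all_bits N) -> In (finv d N f (f w)) (all_bits N) /\ f (finv d N f (f w)) = f w.
Proof.
  intros Hw. unfold finv. destruct (find _ _) as [v|] eqn:F.
  - apply find_some in F as [Hv Ev]. destruct (d (f v) (f w)); [auto|discriminate].
  - pose proof (find_none _ _ F w Hw) as K. simpl in K. destruct (d (f w) (f w)); congruence.
Qed.

(** Keys and common information are functions of [XM], while the constructions below work on sample
    words; this passes from one to the other. *)
Lemma finv_XM m t E n w :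
  (1 <= t)%nat -> well_formed m E -> uniform t E -> In w (all_bits (NN E n)) ->
  finv dLLB (NN E n) (XM m E n) (XM m E n w) = w.
Proof.
  intros Ht Hwf Hu Hw. destruct (finv_spec dLLB (NN E n) (XM m E n) w Hw) as [H1 H2].
  eapply XM_inj; eauto.
Qed.

(** A binary numeral, least significant bit first; the 1 for the empty word is its leading digit, so
    words of different lengths get different codes. *)
Fixpoint code (w : list bool) : nat :=
  match w with
  | [] => 1
  | b :: w => 2 * code w + Nat.b2n b
  end.

Lemma code_inj w w' : code w = code w' -> w = w'.
Proof.
  assert (P : forall w, (1 <= code w)%nat) by (induction w0; cbn [code]; lia).
  revert w'. induction w as [|b w IH]; intros [|b' w'] H; cbn [code] in H; auto.
  - pose proof (P w'). destruct b'; simpl in H; lia.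
  - pose proof (P w). destruct b; simpl in H; lia.
  - assert (b = b' /\ code w = code w') as [-> K] by (destruct b, b'; simpl in H; split; auto; lia).
    f_equal. auto.
Qed.

Definition reveal_all (m : nat) : protocol := map (fun i => (i, fun _ x => code x)) (seq 0 m).

Lemma run_reveal l X acc :
  run (map (fun i => (i, fun _ x => code x)) l) X acc = acc ++ map (fun i => code (X i)) l.
Proof.
  revert acc. induction l as [|i l IH]; intros acc; cbn [map run]; [now rewrite app_nil_r|].
  now rewrite IH, <- app_assoc.
Qed.

Lemma reveal_all_inj m t E n w w' :
  (1 <= t)%nat -> well_formed m E -> uniform t E ->
  In w (all_bits (NN E n)) -> In w' (all_bits (NN E n)) ->
  transcript E n (reveal_all m) w = transcript E n (reveal_all m) w' -> w = w'.
Proof.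
  intros Ht Hwf Hu Hw Hw' H. apply (XM_inj m t E n); auto.
  unfold transcript, reveal_all in H. rewrite !run_reveal in H. cbn [app] in H.
  apply map_ext_in. intros i Hi. apply code_inj. exact (ext_in_map H i Hi).
Qed.

Lemma prob_one N P : (forall w, In w (all_bits N) -> P w = true) -> prob N P = 1.
Proof.
  intros H. unfold prob. rewrite filter_all_true, INR_length_all_bits by exact H.
  field. apply Rgt_not_eq, pow2_pos.
Qed.

Lemma CIW_inf m t E :
  (2 <= m)%nat -> (2 <= t)%nat -> well_formed m E -> uniform t E -> typeS m E ->
  is_inf (CIW_achievable m E) (INR (length E)).
Proof.
  intros Hm Ht Hwf Hu HS. split.
  - intros R0 (L & HL & HR). exact (CIW_rate_lower dN m t E _ R0 Hm Ht Hwf Hu HS HL HR).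
  - intros z Hz. apply Hz.
    exists (fun n y => code (finv dLLB (NN E n) (XM m E n) y)).
    assert (Hinj : forall n w w', In w (all_bits (NN E n)) -> In w' (all_bits (NN E n)) ->
      code (finv dLLB (NN E n) (XM m E n) (XM m E n w)) =
      code (finv dLLB (NN E n) (XM m E n) (XM m E n w')) -> w = w').
    { intros n w w' Hw Hw' H. apply code_inj in H. rewrite !(finv_XM m t) in H by (auto; lia). exact H. }
    split; [apply (is_CIW_inj dN m t); auto; lia|].
    intros eps Heps. exists 1%nat. intros n Hn.
    rewrite entropy_inj by apply Hinj. rewrite INR_NN.
    assert (0 < INR n) by (apply lt_0_INR; lia).
    replace (INR n * INR (length E) / INR n) with (INR (length E)) by (field; lra). lra.
Qed.

Lemma CI_inf m t E :
  (2 <= m)%nat -> (2 <= t)%nat -> well_formed m E -> uniform t E -> typeS m E ->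
  is_inf (CI_achievable m E) (INR (length E)).
Proof.
  intros Hm Ht Hwf Hu HS. split.
  - intros R0 (Fs & J & _ & _ & HL & HR).
    exact (CIW_rate_lower (pair_dec dN dLN) m t E _ R0 Hm Ht Hwf Hu HS HL HR).
  - intros z Hz. apply Hz.
    (* The transcript alone reveals the source, so the common randomness may be constant. *)
    exists (fun _ => reveal_all m), (fun _ _ => 0%nat).
    assert (Hinj : forall n w w', In w (all_bits (NN E n)) -> In w' (all_bits (NN E n)) ->
      (0%nat, transcript E n (reveal_all m) w) = (0%nat, transcript E n (reveal_all m) w') -> w = w').
    { intros n w w' Hw Hw' H. injection H as H. apply (reveal_all_inj m t E n); auto; lia. }
    repeat split.
    + intros _. apply Forall_forall. intros r Hr. apply in_map_iff in Hr as (i & <- & Hi).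
      apply in_seq in Hi. simpl. lia.
    + intros eps Heps. exists 0%nat. intros n _. exists (fun _ _ _ => 0%nat).
      rewrite prob_one; [lra|]. intros w _. now apply forallb_forall.
    + apply (is_CIW_inj (pair_dec dN dLN) m t); auto; lia.
    + intros eps Heps. exists 1%nat. intros n Hn.
      rewrite entropy_inj by apply Hinj. rewrite INR_NN.
      assert (0 < INR n) by (apply lt_0_INR; lia).
      replace (INR n * INR (length E) / INR n) with (INR (length E)) by (field; lra). lra.
Qed.

(** * Lower bound on the communication rate *)

Lemma run_snoc p j g X acc :
  run (p ++ [(j, g)]) X acc = run p X acc ++ [g (run p X acc) (X j)].
Proof.
  revert acc. induction p as [|[i h] p IH]; intros acc; cbn [app run]; [reflexivity|]. apply IH.
Qed.

(* Each transmission is determined by its sender's observation and the past, so its conditional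
   entropy is charged in full to the sender and nonnegatively to the other terminals. *)
Lemma interactive_information m N (X : nat -> list bool -> list bool) (p : protocol) :
  valid_protocol m p ->
  let F := fun w => run p (fun i => X i w) [] in
  entropy dLN N F <=
  sumf (seq 0 m) (fun i => entropy dLB N (X i) + entropy dLN N F
                           - entropy (pair_dec dLB dLN) N (fun w => (X i w, F w))).
Proof.
  induction p as [|[j g] p IH] using rev_ind; intros Hv F.
  - unfold F. cbn [run]. rewrite entropy_trivial by reflexivity.
    rewrite (sumf_ext _ _ (fun _ => 0)), sumf_const; [lra|]. intros i _.
    rewrite (entropy_eq _ dLB N (fun w => (X i w, [])) (X i)); [lra| |];
      intros w w' _ _ H; congruence.
  - apply Forall_app in Hv as [Hv Hj]. specialize (IH Hv).
    apply Forall_inv in Hj. cbn [fst] in Hj.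
    set (G := fun w => run p (fun i => X i w) []) in *. cbv zeta in IH.
    assert (EF : forall w, F w = G w ++ [g (G w) (X j w)]) by (intros; apply run_snoc).
    assert (FG : determines N F G).
    { intros w w' _ _ H. rewrite !EF in H. now apply app_inj_tail in H. }
    (* Compares the increments of the mutual information with [X i] when the last transmission is
       added to [G]. *)
    assert (K : sumf (seq 0 m) (fun i => if dN i j then entropy dLN N F - entropy dLN N G else 0) <=
       sumf (seq 0 m) (fun i => (entropy dLN N F - entropy (pair_dec dLB dLN) N (fun w => (X i w, F w)))
         - (entropy dLN N G - entropy (pair_dec dLB dLN) N (fun w => (X i w, G w))))).
    { apply sumf_le. intros i _. destruct (dN i j) as [->|_].
      (* For the sender, [X j] and [G] already determine the new transmission. *)
      - rewrite (entropy_eq _ (pair_dec dLB dLN) N (fun w => (X j w, F w)) (fun w => (X j w, G w))); [lra| |].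
        + intros w w' Hw Hw' H. injection H as H1 H2. f_equal; auto.
        + intros w w' _ _ H. injection H as H1 H2. rewrite !EF, H1, H2. reflexivity.
      - assert (entropy (pair_dec dLB dLN) N (fun w => (X i w, F w)) + entropy dLN N G <=
          entropy (pair_dec dLB dLN) N (fun w => (X i w, G w)) + entropy dLN N F); [|lra].
        apply entropy_submodular.
        + intros w w' _ _ H. now injection H.
        + exact FG.
        + intros w w' _ _ H. injection H as H1 H2 H3. congruence. }
    rewrite (sumf_single dN) in K; [|apply seq_NoDup|apply in_seq; lia].
    rewrite sumf_minus, !sumf_plus in IH |- *. rewrite !sumf_minus in K. lra.
Qed.

Lemma prob_le N P Q : (forall w, In w (all_bits N) -> P w = true -> Q w = true) -> prob N P <= prob N Q.
Proof.
  intros H. unfold prob. rewrite <- !sumf_b2r.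
  apply Rmult_le_compat_r; [left; apply Rinv_0_lt_compat, pow2_pos|].
  apply sumf_le. intros w Hw. specialize (H w Hw). destruct (P w), (Q w); simpl; try lra; now specialize (H eq_refl).
Qed.

Lemma entropy_transcript_le E n p :
  entropy dLN (NN E n) (transcript E n p) <= log2 (INR (range_size E n p)).
Proof.
  apply entropy_le_log_range. intros w Hw. apply nodup_In. now apply in_map.
Qed.

(** With [L] the key and transcript, Shearer's inequality bounds the sum of the entropies of [X i]
    with [L] from below. Fano's bound replaces [L] by [F] there, and [interactive_information]
    bounds the result from above. The terms [INR t * INR N] cancel. *)
Lemma SK_entropy_bound m t E n p (K : list bool -> nat) Dec delta :
  (2 <= m)%nat -> (1 <= t)%nat -> well_formed m E -> uniform t E -> valid_protocol m p ->
  prob (NN E n) (fun w => forallb (fun i =>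
     Nat.eqb (Dec i (obs E n i w) (transcript E n p w)) (K w)) (seq 0 m)) >= 1 - delta ->
  (INR m - INR t) * entropy (pair_dec dN dLN) (NN E n) (fun w => (K w, transcript E n p w)) <=
  (INR m - 1) * entropy dLN (NN E n) (transcript E n p) + INR m * (2 + delta * INR (NN E n)).
Proof.
  intros Hm Ht Hwf Hu Hv HD.
  set (N := NN E n) in *. set (F := transcript E n p) in *.
  set (L := fun w => (K w, F w)). set (dL := pair_dec dN dLN).
  set (X := fun i w => obs E n i w).
  pose proof (shearer dL N m t (fun i => meets E [i]) L
    (fun q Hq => coordinate_degree m t E n q Hwf Hu Hq)) as H1.
  pose proof (interactive_information m N X p Hv) as H2. cbv zeta in H2.
  change (fun w => run p (fun i => X i w) []) with F in H2.
  assert (H3 : sumf (seq 0 m) (fun i => entropy (pair_dec dLB dL) N (fun w => (sub (meets E [i]) N w, L w)) - entropy dL N L)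
    <= sumf (seq 0 m) (fun i => (entropy (pair_dec dLB dLN) N (fun w => (X i w, F w)) + (2 + delta * INR N)) - entropy dL N L)).
  { apply sumf_le. intros i Hi. apply Rplus_le_compat_r.
    apply (entropy_fano _ _ N _ _ (fun w => Nat.eqb (Dec i (X i w) (F w)) (K w))).
    - intros w w' _ _ G G' EY. injection EY as EX EF. apply Nat.eqb_eq in G, G'.
      unfold L, X in *. rewrite <- G, <- G', EX, EF. fold N. unfold N.
      rewrite <- !obs_sub, EX. reflexivity.
    - apply Rge_trans with (2 := HD). apply Rle_ge, prob_le.
      intros w _ Hw. rewrite forallb_forall in Hw. now apply Hw. }
  assert (H4 : sumf (seq 0 m) (fun i => entropy dLB N (X i)) = INR t * INR N).
  { rewrite (sumf_ext _ _ (fun i => INR n * INR (length (filter (meetsE [i]) E)))).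
    - rewrite sumf_scal, (sum_degrees m t) by assumption. unfold N. rewrite INR_NN. ring.
    - intros i _. rewrite <- entropy_obsA. apply entropy_eq; intros w w' _ _; unfold X, obsA; cbn [map]; congruence. }
  rewrite !sumf_minus, !sumf_plus, !sumf_const, length_seq in H3.
  rewrite sumf_minus, sumf_const, length_seq in H1.
  rewrite sumf_minus, sumf_plus, sumf_const, length_seq, H4 in H2.
  fold L dL. lra.
Qed.

Lemma SK_rate_lower m t E R0 :
  (2 <= m)%nat -> (2 <= t)%nat -> well_formed m E -> uniform t E -> typeS m E ->
  SK_achievable m E R0 -> INR (m - t) / INR (m - 1) * INR (length E) <= R0.
Proof.
  intros Hm Ht Hwf Hu HS [HR0 HR].
  (* For [t > m] the truncated subtraction gives 0, and the claim is the nonnegativity of [R0]. *)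
  destruct (Nat.lt_ge_cases m t) as [Hlt|Htm].
  { replace (m - t)%nat with 0%nat by lia. cbn [INR]. unfold Rdiv. rewrite !Rmult_0_l. exact HR0. }
  pose proof (MMI_rate m t E Hm ltac:(lia) Hwf Hu HS) as HI.
  assert (Hm2 : 2 <= INR m) by (apply (le_INR 2); exact Hm).
  assert (Ht2 : 2 <= INR t) by (apply (le_INR 2); exact Ht).
  assert (Htm' : INR t <= INR m) by (now apply le_INR).
  pose proof (pos_INR (length E)) as HE.
  unfold rate in HI. rewrite !minus_INR in HI |- * by lia. cbn [INR] in HI |- *.
  set (C := 1 + 2 * (INR m - INR t) + INR m * (1 + INR (length E))).
  assert (HC : 0 <= C - 1) by (unfold C; nra).
  apply (le_of_eps _ _ C); [lra|]. intros eps Heps.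
  destruct (HR eps Heps) as (Fs & K & Hv & [HCR HSec] & [N1 H1]).
  destruct (HCR eps Heps) as [N2 H2]. destruct (HSec eps Heps) as [N3 H3].
  (* Beyond [N4] the additive 2 of Fano's bound is at most [INR n * eps]. *)
  destruct (INR_unbounded (2 / eps)) as [N4 H4].
  set (n := (S (N1 + N2 + N3 + N4))%nat).
  destruct (H1 n ltac:(lia)) as [H1a H1b]. destruct (H2 n ltac:(lia)) as [Dec HD].
  specialize (H3 n ltac:(lia)).
  assert (Hn1 : 1 <= INR n) by (apply (le_INR 1); lia).
  assert (Hn2 : 2 <= INR n * eps).
  { assert (INR N4 <= INR n) by (apply le_INR; lia).
    apply Rmult_le_reg_r with (/ eps); [now apply Rinv_0_lt_compat|].
    replace (INR n * eps * / eps) with (INR n) by (field; lra). unfold Rdiv in H4. lra. }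
  pose proof (SK_entropy_bound m t E n (Fs n) (fun w => K n (XM m E n w)) Dec eps Hm ltac:(lia) Hwf Hu (Hv n) HD) as HB.
  pose proof (entropy_transcript_le E n (Fs n)) as HF.
  rewrite HI in H1b. unfold minfo in H3. rewrite INR_NN in HB.
  set (hF := entropy dLN (NN E n) (transcript E n (Fs n))) in *.
  set (hK := entropy dN (NN E n) (fun w => K n (XM m E n w))) in *.
  set (hKF := entropy (pair_dec dN dLN) (NN E n) _) in *.
  assert (HF' : hF <= INR n * (R0 + eps)).
  { apply Rle_trans with (1 := HF). apply Rmult_le_reg_r with (/ INR n); [apply Rinv_0_lt_compat; lra|].
    replace (INR n * (R0 + eps) * / INR n) with (R0 + eps) by (field; lra). exact H1a. }
  set (I := (INR t - 1) * INR (length E) / (INR m - 1)) in *.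
  assert (HK : INR n * (I - eps) <= hK).
  { apply Rmult_le_reg_r with (/ INR n); [apply Rinv_0_lt_compat; lra|].
    replace (INR n * (I - eps) * / INR n) with (I - eps) by (field; lra).
    unfold Rdiv in H1b. lra. }
  assert (Hen : eps <= INR n * eps) by nra.
  (* Near independence of key and transcript makes their joint entropy almost the sum; one [eps] is
     lost to secrecy and one to the key rate. *)
  assert (HKF : hF + INR n * I - 2 * (INR n * eps) <= hKF) by lra.
  assert (M1 : (INR m - INR t) * (hF + INR n * I - 2 * (INR n * eps)) <=
     (INR m - 1) * hF + INR m * (INR n * eps + eps * (INR n * INR (length E)))).
  { apply Rle_trans with ((INR m - INR t) * hKF); [apply Rmult_le_compat_l; lra|].
    apply Rle_trans with (1 := HB). apply Rplus_le_compat_l. apply Rmult_le_compat_l; lra. }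
  assert (M2 : (INR t - 1) * hF <= (INR t - 1) * (INR n * (R0 + eps))) by (apply Rmult_le_compat_l; lra).
  (* Cancelling [hF] in [M1] leaves [(INR t - 1) * hF] against [(INR m - INR t) * I]; this identity
     shows that the quotient by [INR t - 1] is the claimed rate. *)
  assert (EI : (INR m - INR t) * I = (INR t - 1) * ((INR m - INR t) / (INR m - 1) * INR (length E)))
    by (unfold I; field; lra).
  assert (M3 : INR n * ((INR t - 1) * ((INR m - INR t) / (INR m - 1) * INR (length E))) <=
     INR n * ((INR t - 1) * (R0 + eps) + (C - 1) * eps)).
  { rewrite <- EI. unfold C. lra. }
  apply Rmult_le_reg_l in M3; [|lra].
  assert (M4 : (C - 1) * eps <= (INR t - 1) * ((C - 1) * eps)).
  { rewrite <- (Rmult_1_l ((C - 1) * eps)) at 1. apply Rmult_le_compat_r; [|lra]. apply Rmult_le_pos; lra. }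
  apply Rmult_le_reg_l with (INR t - 1); [lra|]. lra.
Qed.

(** * Linear communication for omniscience *)

Fixpoint vxor (v w : list bool) : list bool :=
  match v, w with
  | a :: v, b :: w => xorb a b :: vxor v w
  | _, _ => []
  end.

Fixpoint dot (r v : list bool) : bool :=
  match r, v with
  | a :: r, b :: v => xorb (a && b) (dot r v)
  | _, _ => false
  end.

Lemma length_vxor v w : length v = length w -> length (vxor v w) = length v.
Proof. revert w. induction v as [|a v IH]; intros [|b w] H; cbn in *; auto; discriminate. Qed.

Lemma nth_vxor p v w :
  length v = length w -> nth p (vxor v w) false = xorb (nth p v false) (nth p w false).
Proof.
  revert p w. induction v as [|a v IH]; intros [|p] [|b w] H; cbn in *; auto; discriminate.
Qed.

Lemma vxor_map {A} (f g : A -> bool) l : vxor (map f l) (map g l) = map (fun a => xorb (f a) (g a)) l.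
Proof. induction l as [|a l IH]; cbn; congruence. Qed.

Lemma sub_vxor S N w w' :
  length w = length w' -> sub S N (vxor w w') = vxor (sub S N w) (sub S N w').
Proof.
  intros H. unfold sub. rewrite vxor_map. apply map_ext. intros p. now apply nth_vxor.
Qed.

Lemma dot_vxor r v w : length v = length w -> dot r (vxor v w) = xorb (dot r v) (dot r w).
Proof.
  revert v w. induction r as [|a r IH]; intros [|b v] [|c w] H; cbn in *; auto; try discriminate.
  rewrite IH by congruence. destruct a, b, c, (dot r v), (dot r w); reflexivity.
Qed.

Lemma vxor_involutive v w : length v = length w -> vxor v (vxor v w) = w.
Proof.
  revert w. induction v as [|a v IH]; intros [|b w] H; cbn in *; auto; try discriminate.
  rewrite IH by congruence. f_equal. now destruct a, b.
Qed.

(** * Random parity checks over the two-element field *)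

Definition nonzero (v : list bool) : bool := existsb (fun b => b) v.

Lemma nonzero_false v : nonzero v = false <-> forall p, nth p v false = false.
Proof.
  unfold nonzero. split.
  - intros H p. destruct (nth_in_or_default p v false) as [Hin| ->]; [|reflexivity].
    apply not_true_iff_false. intros E. rewrite E in Hin.
    assert (existsb (fun b => b) v = true) by (apply existsb_exists; eauto). congruence.
  - intros H. apply not_true_iff_false. intros E. apply existsb_exists in E as (b & Hb & Eb).
    subst b. apply (In_nth _ _ false) in Hb as (p & _ & Hp). rewrite H in Hp. discriminate.
Qed.

Lemma nonzero_vxor_false v w : length v = length w -> nonzero (vxor v w) = false -> v = w.
Proof.
  intros Hl H. rewrite nonzero_false in H. apply (word_ext v w (length v)); auto.
  intros p _. specialize (H p). rewrite nth_vxor in H by exact Hl. now apply xorb_eq.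
Qed.

Lemma nonzero_vxor_same v : nonzero (vxor v v) = false.
Proof.
  apply nonzero_false. intros p. rewrite nth_vxor by reflexivity. apply xorb_nilpotent.
Qed.

(** The probability that a uniformly random row is orthogonal to [v]. *)
Definition weight (v : list bool) : R := if nonzero v then / 2 else 1.

Lemma count_orthogonal v :
  sumf (all_bits (length v)) (fun r => b2r (negb (dot r v))) = 2 ^ length v * weight v.
Proof.
  unfold weight. induction v as [|b v IH]; [cbn; lra|].
  cbn [length]. rewrite sumf_all_bits_S. cbn [nonzero existsb].
  change (existsb (fun b => b) v) with (nonzero v). rewrite <- tech_pow_Rmult.
  destruct b; cbn [orb].
  - rewrite (sumf_ext _ _ (fun _ => 1)), sumf_const, INR_length_all_bits; [lra|].
    intros r _. cbn. destruct (dot r v); cbn; lra.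
  - rewrite (sumf_ext _ _ (fun r => 2 * b2r (negb (dot r v)))), sumf_scal, IH; [lra|].
    intros r _. cbn. destruct (dot r v); cbn; lra.
Qed.

(** The probability that [w] passes one independent uniformly random check for each index in
    [js]. *)
Definition potential (V : nat -> list bool -> list bool) (js : list nat) (w : list bool) : R :=
  fold_right (fun j x => weight (V j w) * x) 1 js.

(* Derandomised choice of parity checks: averaging over the row chosen for the first index shows
   that some row does not increase the expected number of words passing all checks. *)
Lemma exists_parity_checks (V : nat -> list bool -> list bool) (len : nat -> nat) js l :
  (forall j w, In w l -> length (V j w) = len j) ->
  sumf l (potential V js) < 1 ->
  exists c : list (nat * list bool), map fst c = js /\
    forall w, In w l -> exists jr, In jr c /\ dot (snd jr) (V (fst jr) w) = true.
Proof.
  revert l. induction js as [|j js IH]; intros l Hlen Hpot.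
  (* With no checks left each word has potential 1, so a sum below 1 leaves no word. *)
  - exists []. split; [reflexivity|]. intros w Hw. exfalso.
    unfold potential in Hpot. cbn in Hpot. rewrite sumf_const in Hpot.
    destruct l; [contradiction|]. cbn [length] in Hpot. rewrite S_INR in Hpot.
    pose proof (pos_INR (length l0)). lra.
  - set (pass := fun r => filter (fun w => negb (dot r (V j w))) l).
    assert (Hr : exists r, sumf (pass r) (potential V js) < 1).
    { apply NNPP. intros Hno.
      assert (K : sumf (all_bits (len j)) (fun _ => 1) <= sumf (all_bits (len j)) (fun r => sumf (pass r) (potential V js))).
      { apply sumf_le. intros r _. apply Rnot_lt_le. eauto. }
      rewrite sumf_const, INR_length_all_bits in K. unfold pass in K.
      rewrite (sumf_ext _ _ (fun r => sumf l (fun w => b2r (negb (dot r (V j w))) * potential V js w))) in K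
        by (intros; apply sumf_filter).
      rewrite sumf_swap, (sumf_ext _ _ (fun w => 2 ^ len j * potential V (j :: js) w)), sumf_scal in K.
      - pose proof (pow2_pos (len j)). nra.
      - intros w Hw. rewrite (sumf_ext _ _ (fun r => potential V js w * b2r (negb (dot r (V j w)))))
          by (intros; lra).
        rewrite sumf_scal, <- (Hlen j w Hw), count_orthogonal. cbn [potential fold_right].
        fold (potential V js w). ring. }
    destruct Hr as [r Hr].
    destruct (IH (pass r)) as (c & Hc & Hd); [|exact Hr|].
    + intros i w Hw. apply Hlen. now apply filter_In in Hw.
    + exists ((j, r) :: c). split; [cbn; congruence|]. intros w Hw.
      destruct (dot r (V j w)) eqn:D.
      * exists (j, r). split; [now left|exact D].
      * destruct (Hd w) as (jr & Hjr & Dj); [apply filter_In; now rewrite D|].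
        exists jr. split; [now right|exact Dj].
Qed.

(** Terminal [j] sends [r j] checks, so its index is repeated that often. *)
Definition schedule (r : nat -> nat) (l : list nat) : list nat := flat_map (fun j => repeat j (r j)) l.

Lemma length_schedule r l : INR (length (schedule r l)) = sumf l (fun j => INR (r j)).
Proof.
  induction l as [|j l IH]; [reflexivity|].
  unfold schedule in *. cbn [flat_map]. rewrite length_app, repeat_length, plus_INR, IH. reflexivity.
Qed.

Lemma potential_schedule V r l w :
  potential V (schedule r l) w =
  (/ 2) ^ length (schedule r (filter (fun j => nonzero (V j w)) l)).
Proof.
  unfold potential, schedule. induction l as [|j l IH]; [reflexivity|].
  cbn [flat_map filter]. rewrite fold_right_app, IH.
  assert (K : forall k x, fold_right (fun j x => weight (V j w) * x) x (repeat j k) = weight (V j w) ^ k * x).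
  { induction k as [|k IHk]; intros x; cbn [repeat fold_right pow]; [lra|]. rewrite IHk. lra. }
  rewrite K. unfold weight. destruct (nonzero (V j w)).
  - cbn [flat_map]. rewrite length_app, repeat_length, pow_add. reflexivity.
  - rewrite pow1. lra.
Qed.

Definition view (E : hypergraph) (n j : nat) (w : list bool) : list bool := sub (meets E [j]) (NN E n) w.

Lemma nonzero_sub_false S N w :
  nonzero (sub S N w) = false <-> forall p, (p < N)%nat -> S p = true -> nth p w false = false.
Proof.
  rewrite <- not_true_iff_false. unfold nonzero, sub. rewrite existsb_exists. split.
  - intros H p Hp HS. apply not_true_iff_false. intros E. apply H. exists true. split; [|reflexivity].
    apply in_map_iff. exists p. split; [exact E|]. apply filter_In. rewrite in_seq. split; [lia|exact HS].
  - intros H (b & Hb & Eb). subst b. apply in_map_iff in Hb as (p & Ep & Hp).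
    apply filter_In in Hp as [Hp HS]. apply in_seq in Hp. rewrite H in Ep; [discriminate|lia|exact HS].
Qed.

(* The nonzero differences of two words that some terminal cannot tell apart by itself. *)
Definition confusable (m : nat) (E : hypergraph) (n : nat) : list (list bool) :=
  filter (fun w => nonzero w && existsb (fun i => negb (nonzero (view E n i w))) (seq 0 m))
    (all_bits (NN E n)).

Definition seers (m : nat) (E : hypergraph) (n : nat) (w : list bool) : list nat :=
  filter (fun j => nonzero (view E n j w)) (seq 0 m).

(** A nonzero bit lies on a hyperedge, whose terminals see it; a confusable word has a terminal that
    sees only zeros. Hence the set is nonempty and proper, and a rate constraint is available for
    it. *)
Lemma seers_co_subset m t E n w :
  (1 <= t)%nat -> well_formed m E -> uniform t E ->
  In w (confusable m E n) -> co_subset m (seers m E n w).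
Proof.
  intros Ht Hwf Hu Hw. apply filter_In in Hw as [Hw H]. apply in_all_bits in Hw.
  apply andb_true_iff in H as [Hnz Hex].
  apply existsb_exists in Hex as (i & Hi & Hiz). apply negb_true_iff in Hiz.
  repeat split.
  - apply NoDup_filter, seq_NoDup.
  - apply incl_filter.
  - intros E0. apply not_false_iff_true in Hnz. apply Hnz, nonzero_false. intros p.
    destruct (Nat.lt_ge_cases p (NN E n)) as [Hp|Hp]; [|apply nth_overflow; lia].
    pose proof (meetsE_all m t E _ Ht Hwf Hu (coordinate_edge E n p Hp)) as K.
    apply meetsE_iff in K as (j & Hj & Hje).
    assert (Hz : nonzero (view E n j w) = false).
    { apply not_true_iff_false. intros Hjz.
      assert (In j (seers m E n w)) as C by (now apply filter_In). now rewrite E0 in C. }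
    unfold view in Hz. rewrite nonzero_sub_false in Hz. apply Hz; [exact Hp|].
    apply meetsE_iff. exists j. split; [now left|exact Hje].
  - rewrite <- (length_seq m 0) at 2. unfold seers.
    pose proof (filter_length (fun j => nonzero (view E n j w)) (seq 0 m)) as Hl.
    assert (In i (filter (fun j => negb (nonzero (view E n j w))) (seq 0 m))) as Hin
      by (apply filter_In; rewrite Hiz; auto).
    destruct (filter (fun j => negb _) _); [contradiction|]. cbn [length] in Hl. lia.
Qed.

(* Words with the same set of seers [B] vanish outside the hyperedges contained in [B]; the rate
   constraint for [B] outweighs their number by a factor [2^(m+1)]. *)
Lemma potential_confusable m t E n r :
  (1 <= t)%nat -> well_formed m E -> uniform t E ->
  (forall B, co_subset m B ->
     (length (filter (fun p => negb (meets E (compl m B) p)) (seq 0 (NN E n))) + (m + 1)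
      <= length (schedule r B))%nat) ->
  sumf (confusable m E n) (potential (view E n) (schedule r (seq 0 m))) <= / 2.
Proof.
  intros Ht Hwf Hu Hr.
  (* The mask encodes the set of seers as a word of length [m], grouping the confusable words into
     at most [2 ^ m] classes. *)
  set (mask := fun w => map (fun j => nonzero (view E n j w)) (seq 0 m)).
  set (g := potential (view E n) (schedule r (seq 0 m))).
  assert (Hg : forall w, g w = (/ 2) ^ length (schedule r (seers m E n w)))
    by (intros; apply potential_schedule).
  assert (Hg0 : forall w, 0 <= g w) by (intros; rewrite Hg; apply pow_le; lra).
  apply Rle_trans with (sumf (all_bits m) (fun v => sumf (confusable m E n) (fun w => same dLB (mask w) v * g w))).
  - rewrite sumf_swap. apply sumf_le. intros w _.
    rewrite (sumf_ext _ _ (fun v => if dLB v (mask w) then g w else 0)).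
    + rewrite sumf_single; [lra|apply NoDup_all_bits|]. apply in_all_bits. unfold mask.
      now rewrite length_map, length_seq.
    + intros v _. unfold same. destruct (dLB _ _), (dLB _ _); try lra; congruence.
  - apply Rle_trans with (sumf (all_bits m) (fun _ => (/ 2) ^ (m + 1))).
    2:{ rewrite sumf_const, INR_length_all_bits, pow_add, <- Rmult_assoc, <- Rpow_mult_distr, Rinv_r, pow1 by lra. lra. }
    apply sumf_le. intros v _.
    destruct (classic (exists w0, In w0 (confusable m E n) /\ mask w0 = v)) as [(w0 & Hw0 & <-)|Hno].
    2:{ rewrite (sumf_ext _ _ (fun _ => 0)), sumf_const; [rewrite Rmult_0_r; apply pow_le; lra|].
        intros w Hw. unfold same. destruct (dLB _ _) as [e|]; [exfalso; eauto|lra]. }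
    set (B := seers m E n w0). specialize (Hr B (seers_co_subset m t E n w0 Ht Hwf Hu Hw0)).
    set (k := length (filter (fun p => negb (meets E (compl m B) p)) (seq 0 (NN E n)))) in *.
    set (zero := repeat false (NN E n)).
    apply Rle_trans with (sumf (all_bits (NN E n)) (fun w => g w0 *
       same dLB (sub (meets E (compl m B)) (NN E n) w) (sub (meets E (compl m B)) (NN E n) zero))).
    + unfold confusable. rewrite sumf_filter. apply sumf_le. intros w Hw.
      pose proof (Rmult_le_pos _ _ (Hg0 w0) (same_nonneg dLB (sub (meets E (compl m B)) (NN E n) w) (sub (meets E (compl m B)) (NN E n) zero))).
      destruct (andb _ _); cbn [b2r]; [|lra].
      unfold same at 1. destruct (dLB (mask w) (mask w0)) as [e|]; [|lra].
      assert (Hs : forall j, In j (seq 0 m) -> nonzero (view E n j w) = nonzero (view E n j w0))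
        by (intros j Hj; exact (ext_in_map e j Hj)).
      rewrite !Hg. replace (seers m E n w) with (seers m E n w0)
        by (symmetry; apply filter_ext_in; exact Hs).
      replace (sub (meets E (compl m B)) (NN E n) w) with (sub (meets E (compl m B)) (NN E n) zero);
        [rewrite same_refl; lra|].
      apply sub_eq. intros p Hp HM. unfold zero. rewrite nth_repeat. symmetry.
      apply meetsE_iff in HM as (j & Hj & Hje). apply inE_compl in Hj as [Hjm HjB].
      assert (Hz : nonzero (view E n j w) = false).
      { rewrite Hs by (apply in_seq; lia). apply not_true_iff_false. intros Hc. apply HjB.
        apply filter_In. rewrite in_seq. split; [lia|exact Hc]. }
      unfold view in Hz. rewrite nonzero_sub_false in Hz. apply Hz; [exact Hp|].
      apply meetsE_iff. exists j. split; [now left|exact Hje].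
    + rewrite sumf_scal. fold (kcard dLB (NN E n) (sub (meets E (compl m B)) (NN E n)) zero).
      rewrite kcard_sub by apply repeat_length. fold k. rewrite Hg. fold B.
      assert (K : (/ 2) ^ length (schedule r B) <= (/ 2) ^ (k + (m + 1))).
      { rewrite !pow_inv. apply Rinv_le_contravar; [apply pow2_pos|]. apply Rle_pow; [lra|exact Hr]. }
      (* A class has at most [2 ^ k] words, where [k] counts the coordinates that no terminal
         outside [B] sees; its total is thus at most [(/ 2) ^ (m + 1)]. *)
      apply Rle_trans with ((/ 2) ^ (k + (m + 1)) * 2 ^ k).
      * apply Rmult_le_compat_r; [left; apply pow2_pos|exact K].
      * rewrite pow_add, (Rmult_comm ((/ 2) ^ k)), Rmult_assoc, <- Rpow_mult_distr, Rinv_l, pow1 by lra. lra.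
Qed.

(** [up x] is strictly above [x], so an integer is rounded up to its successor; the bounds used
    below allow for this. *)
Definition nat_ceil (x : R) : nat := Z.to_nat (up x).

Lemma nat_ceil_bounds x : 0 <= x -> x <= INR (nat_ceil x) <= x + 1.
Proof.
  intros Hx. unfold nat_ceil. destruct (archimed x) as [H1 H2].
  assert (0 <= up x)%Z by (apply le_IZR; simpl; lra).
  rewrite INR_IZR_INZ, Z2Nat.id by assumption. lra.
Qed.

(** The rate constraint for a single terminal, whose right-hand side counts hyperedges. Rounding a
    rate up to a number of checks relies on it. *)
Lemma co_rate_nonneg m t E j :
  (2 <= m)%nat -> (1 <= t)%nat -> well_formed m E -> uniform t E -> typeS m E ->
  (j < m)%nat -> 0 <= co_rate m t E j.
Proof.
  intros Hm Ht Hwf Hu HS Hj.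
  assert (Hi : incl [j] (seq 0 m)) by (intros i [<-|[]]; apply in_seq; lia).
  pose proof (co_rate_feasible m t E Hm Ht Hwf Hu HS [j]) as H.
  rewrite (centropy_compl m t) in H by assumption.
  assert (INR (length (filter (meetsE (compl m [j])) E)) <= INR (length E)) by apply le_INR, filter_length_le.
  assert (sum_R (map (co_rate m t E) [j]) >=
     INR (length E) - INR (length (filter (meetsE (compl m [j])) E))).
  { apply H. repeat split; [repeat constructor; simpl; tauto|exact Hi|discriminate|simpl; lia]. }
  cbn in H1. lra.
Qed.

Lemma exists_omniscience_checks m t E n :
  (2 <= m)%nat -> (1 <= t)%nat -> well_formed m E -> uniform t E -> typeS m E ->
  exists c : list (nat * list bool),
    Forall (fun jr => (fst jr < m)%nat) c /\
    INR (length c) <= INR n * (INR (m - t) / INR (m - 1) * INR (length E)) + INR m * (INR m + 2) /\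
    forall w, In w (confusable m E n) ->
      exists jr, In jr c /\ dot (snd jr) (view E n (fst jr) w) = true.
Proof.
  intros Hm Ht Hwf Hu HS.
  (* The surplus [m + 1] pays for the union bound over the classes of confusable words; rounding up
     costs at most one more check per terminal. *)
  set (r := fun j => (nat_ceil (INR n * co_rate m t E j) + (m + 1))%nat).
  assert (Hr : forall j, In j (seq 0 m) ->
    INR n * co_rate m t E j + (INR m + 1) <= INR (r j) <= INR n * co_rate m t E j + (INR m + 2)).
  { intros j Hj. apply in_seq in Hj.
    assert (0 <= INR n * co_rate m t E j) as H0
      by (apply Rmult_le_pos; [apply pos_INR|apply co_rate_nonneg; auto; lia]).
    pose proof (nat_ceil_bounds _ H0). unfold r. rewrite !plus_INR. cbn [INR]. lra. }
  destruct (exists_parity_checks (view E n) (fun j => length (filter (meets E [j]) (seq 0 (NN E n))))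
     (schedule r (seq 0 m)) (confusable m E n)) as (c & Hc & Hd).
  - intros j w _. apply length_map.
  - apply Rle_lt_trans with (/ 2); [|lra]. apply (potential_confusable m t); auto.
    intros B HB. apply INR_le. rewrite length_schedule, !plus_INR. cbn [INR].
    pose proof (co_rate_feasible m t E Hm Ht Hwf Hu HS B HB) as Hf.
    destruct HB as (Hn & Hi & Hne & _).
    rewrite (centropy_compl m t) in Hf by assumption.
    change (sum_R (map (co_rate m t E) B)) with (sumf B (co_rate m t E)) in Hf.
    pose proof (filter_length (meets E (compl m B)) (seq 0 (NN E n))) as Hl.
    apply (f_equal INR) in Hl. rewrite plus_INR, count_meets, length_seq, mult_INR, INR_NN in Hl.
    assert (H1 : sumf B (fun j => INR n * co_rate m t E j + (INR m + 1)) <= sumf B (fun j => INR (r j)))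
      by (apply sumf_le; intros j Hj; now apply Hr, Hi).
    rewrite sumf_plus, sumf_scal, sumf_const in H1.
    (* As [B] is nonempty, the surplus is present at least once. *)
    assert (H2 : 1 * (INR m + 1) <= INR (length B) * (INR m + 1)).
    { apply Rmult_le_compat_r; [pose proof (pos_INR m); lra|]. apply (le_INR 1).
      destruct B; [congruence|simpl; lia]. }
    assert (H3 : INR n * (INR (length E) - INR (length (filter (meetsE (compl m B)) E)))
       <= INR n * sumf B (co_rate m t E)) by (apply Rmult_le_compat_l; [apply pos_INR|lra]).
    lra.
  - exists c. repeat split; [| |exact Hd].
    + apply Forall_forall. intros jr Hjr. apply (in_map fst) in Hjr. rewrite Hc in Hjr.
      apply in_flat_map in Hjr as (j & Hj & Hjr). apply repeat_spec in Hjr. apply in_seq in Hj. lia.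
    + rewrite <- (length_map fst), Hc, length_schedule.
      apply Rle_trans with (sumf (seq 0 m) (fun j => INR n * co_rate m t E j + (INR m + 2))).
      * apply sumf_le. intros j Hj. now apply Hr.
      * rewrite sumf_plus, sumf_scal, sumf_const, length_seq, (sum_co_rate m t) by assumption. lra.
Qed.

(** * The protocol given by parity checks, and error-free recovery *)

Definition linear_protocol (c : list (nat * list bool)) : protocol :=
  map (fun jr => (fst jr, fun _ x => Nat.b2n (dot (snd jr) x))) c.

Lemma linear_transcript E n c w :
  transcript E n (linear_protocol c) w =
  map Nat.b2n (map (fun jr => dot (snd jr) (view E n (fst jr) w)) c).
Proof.
  unfold transcript, linear_protocol. rewrite <- (app_nil_l (map Nat.b2n _)).
  generalize (@nil nat). induction c as [|[j r] c IH]; intros acc; cbn [map run fst snd].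
  - now rewrite app_nil_r.
  - rewrite IH, <- app_assoc, obs_sub. reflexivity.
Qed.

Lemma linear_transcript_eq E n c w w' :
  length w = length w' ->
  transcript E n (linear_protocol c) w = transcript E n (linear_protocol c) w' <->
  forall jr, In jr c -> dot (snd jr) (view E n (fst jr) (vxor w w')) = false.
Proof.
  intros Hl. rewrite !linear_transcript, !map_map.
  assert (K : forall jr, dot (snd jr) (view E n (fst jr) (vxor w w')) =
    xorb (dot (snd jr) (view E n (fst jr) w)) (dot (snd jr) (view E n (fst jr) w'))).
  { intros jr. unfold view. rewrite sub_vxor, dot_vxor; auto. unfold sub. now rewrite !length_map. }
  split.
  - intros H jr Hjr. pose proof (ext_in_map H jr Hjr) as E'. cbn beta in E'. apply Nat.b2n_inj in E'.
    rewrite K, E'. apply xorb_nilpotent.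
  - intros H. apply map_ext_in. intros jr Hjr. f_equal. apply xorb_eq. rewrite <- K. auto.
Qed.

(** The difference of two distinct words that look alike to terminal [i] is confusable, so some
    parity check would separate their transcripts. *)
Lemma omniscience m E n c i w w' :
  (forall w, In w (confusable m E n) ->
      exists jr, In jr c /\ dot (snd jr) (view E n (fst jr) w) = true) ->
  (i < m)%nat -> In w (all_bits (NN E n)) -> In w' (all_bits (NN E n)) ->
  obs E n i w = obs E n i w' ->
  transcript E n (linear_protocol c) w = transcript E n (linear_protocol c) w' -> w = w'.
Proof.
  intros Hc Hi Hw Hw' HX HF. apply in_all_bits in Hw, Hw'.
  rewrite linear_transcript_eq in HF by congruence.
  apply nonzero_vxor_false; [congruence|]. apply not_true_iff_false. intros Hnz.
  destruct (Hc (vxor w w')) as (jr & Hjr & Hd); [|rewrite HF in Hd by exact Hjr; discriminate].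
  apply filter_In. split; [apply in_all_bits; rewrite length_vxor; congruence|].
  rewrite Hnz. cbn [andb]. apply existsb_exists. exists i. split; [apply in_seq; lia|].
  apply negb_true_iff. unfold view. rewrite sub_vxor, <- !obs_sub, HX by congruence.
  apply nonzero_vxor_same.
Qed.

Lemma range_size_linear E n c :
  INR (range_size E n (linear_protocol c)) <= 2 ^ length c.
Proof.
  rewrite <- INR_length_all_bits. apply le_INR.
  rewrite <- (length_map (map Nat.b2n)). unfold range_size.
  apply NoDup_incl_length; [apply NoDup_nodup|]. intros x Hx. apply nodup_In in Hx.
  apply in_map_iff in Hx as (w & <- & _). rewrite linear_transcript. apply in_map.
  apply in_all_bits. apply length_map.
Qed.

Lemma range_size_pos E n p : 0 < INR (range_size E n p).
Proof.
  apply lt_0_INR. unfold range_size.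
  assert (H : In (transcript E n p (repeat false (NN E n)))
    (nodup dLN (map (transcript E n p) (all_bits (NN E n))))).
  { apply nodup_In, in_map, in_all_bits, repeat_length. }
  destruct (nodup _ _); [contradiction|simpl; lia].
Qed.

(** * Key extraction *)

Definition fibre (E : hypergraph) n p (w : list bool) : list (list bool) :=
  filter (fun v => if dLN (transcript E n p v) (transcript E n p w) then true else false)
    (all_bits (NN E n)).

Lemma in_fibre E n p w v :
  In v (fibre E n p w) <-> In v (all_bits (NN E n)) /\ transcript E n p v = transcript E n p w.
Proof.
  unfold fibre. rewrite filter_In. destruct (dLN _ _); intuition congruence.
Qed.

Lemma kcard_fibre E n p w :
  kcard dLN (NN E n) (transcript E n p) w = INR (length (fibre E n p w)).
Proof.
  unfold fibre. rewrite <- sumf_b2r. apply sumf_ext. intros v _. unfold same. now destruct (dLN _ _).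
Qed.

(* The fibres of a linear transcript are translates of one another. *)
Lemma length_fibre_le E n c w w' :
  In w (all_bits (NN E n)) -> In w' (all_bits (NN E n)) ->
  (length (fibre E n (linear_protocol c) w) <= length (fibre E n (linear_protocol c) w'))%nat.
Proof.
  intros Hw Hw'. set (u := vxor w w'). apply in_all_bits in Hw, Hw'.
  assert (Hu : length u = NN E n) by (unfold u; rewrite length_vxor; congruence).
  rewrite <- (length_map (vxor u)). apply NoDup_incl_length.
  - apply NoDup_map_NoDup_ForallPairs; [|apply NoDup_filter, NoDup_all_bits].
    intros x y Hx Hy H. apply in_fibre in Hx as [Hx _]. apply in_fibre in Hy as [Hy _].
    apply in_all_bits in Hx, Hy.
    rewrite <- (vxor_involutive u x), <- (vxor_involutive u y), H by congruence. reflexivity.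
  - intros x Hx. apply in_map_iff in Hx as (v & <- & Hv). apply in_fibre in Hv as [Hv HF].
    apply in_all_bits in Hv.
    assert (Huv : length (vxor u v) = NN E n) by (rewrite length_vxor; congruence).
    apply in_fibre. split; [now apply in_all_bits|].
    rewrite linear_transcript_eq in HF |- * by congruence.
    replace (vxor (vxor u v) w') with (vxor v w); [exact HF|].
    apply (word_ext _ _ (NN E n)); [rewrite length_vxor; congruence..|].
    intros q _. rewrite !nth_vxor by congruence. unfold u. rewrite nth_vxor by congruence.
    destruct (nth q v false), (nth q w false), (nth q w' false); reflexivity.
Qed.

Fixpoint position (w : list bool) (l : list (list bool)) : nat :=
  match l with
  | [] => 0
  | v :: l => if dLB v w then 0 else S (position w l)
  end.

Lemma position_spec w l : In w l -> (position w l < length l)%nat /\ nth (position w l) l [] = w.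
Proof.
  induction l as [|v l IH]; [easy|]. cbn [position length]. intros [->|H].
  - destruct (dLB w w); [|congruence]. split; [lia|reflexivity].
  - destruct (dLB v w) as [->|]; [split; [lia|reflexivity]|]. destruct (IH H). split; [lia|assumption].
Qed.

Definition fibre_index (E : hypergraph) n p (w : list bool) : nat := position w (fibre E n p w).

(** The fibre depends only on the transcript, so transcript and index locate the word. *)
Lemma fibre_index_inj E n p w w' :
  In w (all_bits (NN E n)) -> In w' (all_bits (NN E n)) ->
  (fibre_index E n p w, transcript E n p w) = (fibre_index E n p w', transcript E n p w') -> w = w'.
Proof.
  intros Hw Hw' H. injection H as H1 H2. unfold fibre_index in H1.
  assert (EF : fibre E n p w = fibre E n p w') by (unfold fibre; now rewrite H2).
  destruct (position_spec w (fibre E n p w)) as [_ K]; [now apply in_fibre|].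
  destruct (position_spec w' (fibre E n p w')) as [_ K']; [now apply in_fibre|].
  rewrite <- K, <- K', H1, EF. reflexivity.
Qed.

(* The index is uniform on each fibre, and all fibres have the same size. *)
Lemma fibre_index_secret E n c :
  minfo dN dLN (NN E n) (fibre_index E n (linear_protocol c)) (transcript E n (linear_protocol c)) <= 0.
Proof.
  set (p := linear_protocol c). set (zero := repeat false (NN E n)).
  assert (Hz : In zero (all_bits (NN E n))) by (apply in_all_bits, repeat_length).
  unfold minfo. rewrite (entropy_inj (pair_dec dN dLN)) by apply fibre_index_inj.
  assert (Hc : forall w, In w (all_bits (NN E n)) -> length (fibre E n p w) = length (fibre E n p zero))
    by (intros w Hw; apply Nat.le_antisymm; now apply length_fibre_le).
  rewrite (entropy_const_class dLN _ _ (INR (length (fibre E n p zero)))).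
  - assert (entropy dN (NN E n) (fibre_index E n p) <= log2 (INR (length (seq 0 (length (fibre E n p zero)))))) as K.
    { apply entropy_le_log_range. intros w Hw. apply in_seq. rewrite <- (Hc w Hw).
      pose proof (proj1 (position_spec w (fibre E n p w) (proj2 (in_fibre E n p w w) (conj Hw eq_refl)))).
      unfold fibre_index. lia. }
    rewrite length_seq in K. lra.
  - rewrite <- kcard_fibre. pose proof (kcard_ge1 dLN (NN E n) (transcript E n p) zero Hz). lra.
  - intros w Hw. rewrite kcard_fibre. f_equal. now apply Hc.
Qed.

(** Index and transcript together have the full entropy of the source, and the transcript accounts
    for at most the logarithm of its range. *)
Lemma fibre_index_entropy E n p :
  INR (NN E n) - log2 (INR (range_size E n p)) <= entropy dN (NN E n) (fibre_index E n p).
Proof.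
  pose proof (entropy_subadditive dN dLN (pair_dec dN dLN) (NN E n)
    (fibre_index E n p) (transcript E n p) _ (fun w w' _ _ H => H)) as H.
  rewrite (entropy_inj (pair_dec dN dLN)) in H by apply fibre_index_inj.
  pose proof (entropy_transcript_le E n p). lra.
Qed.

Lemma entropy_ext {T} (d : dec T) N f g :
  (forall w, In w (all_bits N) -> f w = g w) -> entropy d N f = entropy d N g.
Proof.
  intros H. apply entropy_eq; intros w w' Hw Hw' E'; [rewrite <- !H|rewrite !H]; auto.
Qed.

Lemma SK_achieves m t E :
  (2 <= m)%nat -> (1 <= t)%nat -> well_formed m E -> uniform t E -> typeS m E ->
  SK_achievable m E (INR (m - t) / INR (m - 1) * INR (length E)).
Proof.
  intros Hm Ht Hwf Hu HS.
  assert (Hm1 : 1 <= INR (m - 1)) by (apply (le_INR 1); lia).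
  set (R0 := INR (m - t) / INR (m - 1) * INR (length E)).
  split.
  { apply Rmult_le_pos; [|apply pos_INR]. apply Rmult_le_pos; [apply pos_INR|].
    left. apply Rinv_0_lt_compat. lra. }
  intros eps Heps.
  (* The checks exist separately for each blocklength; choice assembles them into a sequence of
     protocols. *)
  set (c := fun n => proj1_sig (constructive_indefinite_description _
     (exists_omniscience_checks m t E n Hm Ht Hwf Hu HS))).
  assert (Hc : forall n, Forall (fun jr => (fst jr < m)%nat) (c n) /\
    INR (length (c n)) <= INR n * R0 + INR m * (INR m + 2) /\
    forall w, In w (confusable m E n) ->
      exists jr, In jr (c n) /\ dot (snd jr) (view E n (fst jr) w) = true)
    by (intros n; exact (proj2_sig (constructive_indefinite_description _
          (exists_omniscience_checks m t E n Hm Ht Hwf Hu HS)))).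
  set (Fs := fun n => linear_protocol (c n)).
  set (K := fun n y => fibre_index E n (Fs n) (finv dLLB (NN E n) (XM m E n) y)).
  assert (HK : forall n w, In w (all_bits (NN E n)) -> K n (XM m E n w) = fibre_index E n (Fs n) w).
  { intros n w Hw. unfold K. now rewrite (finv_XM m t) by auto. }
  exists Fs, K. repeat split.
  - intros n. destruct (Hc n) as [Hv _]. unfold valid_protocol, Fs, linear_protocol.
    apply Forall_map. exact Hv.
  - intros e He. exists 0%nat. intros n _.
    (* Terminal [i] takes a word consistent with its observation and the transcript; by omniscience
       it is the true one, so decoding never fails. *)
    exists (fun i x f => fibre_index E n (Fs n)
       (finv (pair_dec dLB dLN) (NN E n) (fun w => (obs E n i w, transcript E n (Fs n) w)) (x, f))).
    rewrite prob_one; [lra|]. intros w Hw. apply forallb_forall. intros i Hi. apply in_seq in Hi.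
    apply Nat.eqb_eq. rewrite HK by exact Hw. f_equal.
    destruct (finv_spec (pair_dec dLB dLN) (NN E n) (fun w => (obs E n i w, transcript E n (Fs n) w)) w Hw) as [H1 H2].
    apply pair_equal_spec in H2 as [H2 H3].
    apply (omniscience m E n (c n) i); auto; [apply Hc|lia].
  - intros e He. exists 0%nat. intros n _.
    pose proof (fibre_index_secret E n (c n)) as H. fold (Fs n) in H. unfold minfo in *.
    rewrite (entropy_ext dN _ _ (fibre_index E n (Fs n))) by (intros; now apply HK).
    rewrite (entropy_ext (pair_dec dN dLN) _ _ (fun w => (fibre_index E n (Fs n) w, transcript E n (Fs n) w)))
      by (intros; now rewrite HK).
    lra.
  (* From here on the constant overhead in the number of checks is at most [INR n * eps]. *)
  - destruct (INR_unbounded (INR m * (INR m + 2) / eps)) as [N0 HN0].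
    exists (S N0). intros n Hn.
    assert (Hn1 : 1 <= INR n) by (apply (le_INR 1); lia).
    assert (Hn2 : INR m * (INR m + 2) <= INR n * eps).
    { assert (INR N0 <= INR n) by (apply le_INR; lia).
      apply Rmult_le_reg_r with (/ eps); [now apply Rinv_0_lt_compat|].
      replace (INR n * eps * / eps) with (INR n) by (field; lra). unfold Rdiv in HN0. lra. }
    destruct (Hc n) as (_ & Hlen & _).
    assert (HR : log2 (INR (range_size E n (Fs n))) <= INR n * (R0 + eps)).
    { apply Rle_trans with (INR (length (c n))); [|lra].
      rewrite <- (log2_pow2 (length (c n))). apply log2_le; [apply range_size_pos|apply range_size_linear]. }
    assert (Hdiv : forall x y, x <= INR n * y -> x / INR n <= y).
    { intros x y H. apply Rmult_le_reg_r with (INR n); [lra|].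
      unfold Rdiv. rewrite Rmult_assoc, Rinv_l by lra. lra. }
    split; [now apply Hdiv|].
    rewrite (entropy_ext dN _ _ (fibre_index E n (Fs n))) by (intros; now apply HK).
    pose proof (fibre_index_entropy E n (Fs n)) as HE. rewrite INR_NN in HE.
    rewrite (MMI_rate m t) by assumption.
    (* Key capacity is the source entropy minus the rate of omniscience, so the part of the source
       not spent on communication is exactly the key. *)
    assert (EI : rate m t E = INR (length E) - R0).
    { pose proof (sum_co_rate m t E Hm Ht Hwf Hu) as Hs. fold R0 in Hs.
      unfold co_rate in Hs. rewrite sumf_minus, sumf_const, length_seq in Hs.
      unfold degree in Hs. rewrite (sum_degrees m t) in Hs by assumption. rewrite <- Hs.
      unfold rate. rewrite !minus_INR by lia. cbn [INR].
      rewrite minus_INR in Hm1 by lia. cbn [INR] in Hm1. field. lra. }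
    rewrite EI. apply Rle_ge. apply Rmult_le_reg_r with (INR n); [lra|].
    unfold Rdiv. rewrite Rmult_assoc, Rinv_l by lra. lra.
Qed.

Theorem theorem2 (m t : nat) (E : hypergraph) :
  (2 <= m)%nat -> (2 <= t)%nat ->
  well_formed m E -> uniform t E -> typeS m E ->
  is_inf (CI_achievable m E) (INR (length E)) /\
  is_inf (CIW_achievable m E) (INR (length E)) /\
  HA E (seq 0 m) = INR (length E) /\
  is_inf (SK_achievable m E) (INR (m - t) / INR (m - 1) * INR (length E)) /\
  is_min (co_sums m E) (INR (m - t) / INR (m - 1) * INR (length E)).
Proof.
  intros Hm Ht Hwf Hu HS. assert (Ht1 : (1 <= t)%nat) by lia.
  split; [|split; [|split; [|split]]].
  - now apply (CI_inf m t).
  - now apply (CIW_inf m t).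
  - now apply (HA_all m t).
  - split.
    + intros R0 HR. now apply (SK_rate_lower m t).
    + intros z Hz. apply Hz. now apply SK_achieves.
  - now apply co_sums_min.
Qed.
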